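(* There exist absolute constants $c_1,c_2,c_3>0$ such that the following holds. Let $\delta>0$, $n> c_1\kappa\alpha^2\left(\ln(2c_1\kappa\alpha^2/\delta)\right)^7$ and $0<\epsilon_0 < \frac{1}{8e^2\sqrt{\alpha}}$. Let $b\geq 1$ satisfy $b < \frac{n}{c_2\alpha\ln(n/\kappa)}$, let $\beta = 32\ln\left(\frac{n}{2\alpha^2\kappa}\right)$ and $\eta = \frac{b\sqrt{\alpha}\beta}{n}$, and let $\tilde{\mathbf x}_0 \in \mathcal{U}_f(\epsilon_0\eta)$. Let $\tilde{\mathbf x}_s$ be the outer iterate after $s$ outer iterations of the algorithm Mb-SVRN started at $\tilde{\mathbf x}_0$, with gradient mini-batch size $b$, step size $\eta$, a Hessian oracle with approximation factor $\alpha$, and $t_{\max}=n/b$ inner iterations per outer iteration. Then with probability at least $1-2\delta$: $$f(\tilde{\mathbf x}_{s}) -f(\mathbf x^* ) \leq \left(\frac{c_3\kappa\alpha^2(\ln(n/\delta))^2}{n}\right)^{s}\cdot \left(f(\tilde{\mathbf x}_0) - f(\mathbf x^* )\right).$$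
   Context: Setting. Let $f:\mathbb R^d\to\mathbb R$, $f(\mathbf x)=\frac1n\sum_{i=1}^n\psi_i(\mathbf x)$, be twice continuously differentiable, where each $\psi_i:\mathbb R^d\to\mathbb R$ is convex and $\lambda$-smooth, i.e. $\psi_i(\mathbf y)\le\psi_i(\mathbf x)+\nabla\psi_i(\mathbf x)^\top(\mathbf y-\mathbf x)+\frac\lambda2\|\mathbf y-\mathbf x\|^2$ for all $\mathbf x,\mathbf y$; $f$ is $\mu$-strongly convex, i.e. $f(\mathbf y)\ge f(\mathbf x)+\nabla f(\mathbf x)^\top(\mathbf y-\mathbf x)+\frac\mu2\|\mathbf y-\mathbf x\|^2$ for all $\mathbf x,\mathbf y$; and the Hessian is $L$-Lipschitz, i.e. $\|\nabla^2f(\mathbf x)-\nabla^2f(\mathbf y)\|\le L\|\mathbf x-\mathbf y\|$ for all $\mathbf x,\mathbf y$. Here $\lambda,\mu,L>0$, and $\|\cdot\|$ is the Euclidean norm on vectors and the spectral norm on matrices. Put $\kappa=\lambda/\mu$, let $\mathbf x^*$ be the minimizer of $f$, $\mathbf H=\nabla^2f(\mathbf x^* )$, and $\|\mathbf v\|_{\mathbf H}=\sqrt{\mathbf v^\top\mathbf H\mathbf v}$. For $\epsilon>0$, $\mathcal U_f(\epsilon)=\{\mathbf x:\|\mathbf x-\mathbf x^*\|_{\mathbf H}<\frac{\mu^{3/2}}{L}\epsilon\}$. Let $\alpha\ge1$. Hessian oracle with approximation factor $\alpha$: at a query point $\mathbf x$ it returns a symmetric matrix $\hat{\mathbf H}$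 with $\frac1{\sqrt\alpha}\nabla^2f(\mathbf x)\preceq\hat{\mathbf H}\preceq\sqrt\alpha\,\nabla^2f(\mathbf x)$. Algorithm Mb-SVRN. Inputs: $\tilde{\mathbf x}_0$, mini-batch size $b$ ($1\le b\le n$), step size $\eta$, number of inner iterations $t_{\max}$ ($n/b$ is treated as an integer). For $s=0,1,2,\dots$: obtain $\hat{\mathbf H}_s$ from the Hessian oracle at $\tilde{\mathbf x}_s$; compute $\mathbf g_s=\nabla f(\tilde{\mathbf x}_s)$; set $\mathbf x_{0,s}=\tilde{\mathbf x}_s$; for $t=0,\dots,t_{\max}-1$ draw fresh indices $i_1,\dots,i_b$ independently and uniformly from $\{1,\dots,n\}$, set $\bar{\mathbf g}_{t,s}=\frac1b\sum_{j=1}^b\nabla\psi_{i_j}(\mathbf x_{t,s})-\frac1b\sum_{j=1}^b\nabla\psi_{i_j}(\tilde{\mathbf x}_s)+\mathbf g_s$ and $\mathbf x_{t+1,s}=\mathbf x_{t,s}-\eta\hat{\mathbf H}_s^{-1}\bar{\mathbf g}_{t,s}$; finally set $\tilde{\mathbf x}_{s+1}=\mathbf x_{t_{\max},s}$. *)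

(* Defs.v *)
From HB Require Import structures.
From mathcomp Require Import all_boot all_order all_algebra.
From mathcomp Require Import all_classical all_reals all_analysis.

Set Implicit Arguments.
Unset Strict Implicit.
Unset Printing Implicit Defensive.

Import Order.TTheory GRing.Theory Num.Theory.
Import numFieldNormedType.Exports.

Local Open Scope classical_set_scope.
Local Open Scope ring_scope.

(* The library norm on matrices is the sup norm of the entries; the Euclidean
   and spectral norms are therefore defined here.  Differentiability and
   continuity are insensitive to the choice of norm. *)

Definition dotv (R : realType) (d : nat) (u v : 'cV[R]_d) : R :=
  \sum_(i < d) u i 0 * v i 0.

Definition enorm (R : realType) (d : nat) (v : 'cV[R]_d) : R :=
  Num.sqrt (dotv v v).

Definition spectral_norm (R : realType) (d : nat) (A : 'M[R]_d) : R :=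
  sup [set enorm (A *m v) | v in [set v : 'cV[R]_d | enorm v <= 1]].

Definition mxnorm (R : realType) (d : nat) (H : 'M[R]_d) (v : 'cV[R]_d) : R :=
  Num.sqrt (dotv v (H *m v)).

Definition loewner_le (R : realType) (d : nat) (A B : 'M[R]_d) : Prop :=
  forall v : 'cV[R]_d, dotv v (A *m v) <= dotv v (B *m v).

Definition grad (R : realType) (d : nat) (f : 'cV[R]_d -> R) (x : 'cV[R]_d) :
    'cV[R]_d :=
  \col_(i < d) 'D_(delta_mx i 0) f x.

Definition hess (R : realType) (d : nat) (f : 'cV[R]_d -> R) (x : 'cV[R]_d) :
    'M[R]_d :=
  \matrix_(i < d, j < d)
    'D_(delta_mx j 0) (fun y : 'cV[R]_d => grad f y i 0) x.

Definition twice_continuously_differentiable (R : realType) (d : nat)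
    (f : 'cV[R]_d -> R) : Prop :=
  [/\ forall x, differentiable f x,
      forall x, differentiable (grad f) x &
      continuous (hess f)].

Definition smooth (R : realType) (d : nat) (lambda : R) (g : 'cV[R]_d -> R) :
    Prop :=
  forall x y, g y <= g x + dotv (grad g x) (y - x)
                     + lambda / 2 * enorm (y - x) ^+ 2.

Definition strongly_convex (R : realType) (d : nat) (mu : R)
    (f : 'cV[R]_d -> R) : Prop :=
  forall x y, f x + dotv (grad f x) (y - x) + mu / 2 * enorm (y - x) ^+ 2
              <= f y.

Definition hessian_lipschitz (R : realType) (d : nat) (L : R)
    (f : 'cV[R]_d -> R) : Prop :=
  forall x y, spectral_norm (hess f x - hess f y) <= L * enorm (x - y).

Definition neighborhood (R : realType) (d : nat) (f : 'cV[R]_d -> R)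
    (mu L : R) (xstar : 'cV[R]_d) (eps : R) : set 'cV[R]_d :=
  [set x | mxnorm (hess f xstar) (x - xstar) < mu `^ (3 / 2) / L * eps].

(* The index draws of one outer iteration: m mini-batches of b indices each,
   listed in the order in which they are drawn. *)
Definition epoch (n b m : nat) : finType := m.-tuple (b.-tuple 'I_n).

(* The answer of the oracle may depend on the query point and on all the
   indices drawn in the previous outer iterations (hence also on its number of
   previous calls and on its previous answers), but not on later draws: these
   are fresh.  As no law is imposed on the oracle, one using randomness
   independent of the draws is covered by fixing the value of its seed. *)
Definition hessian_oracle (R : realType) (d n b m : nat) (alpha : R)
    (f : 'cV[R]_d -> R)
    (oracle : seq (epoch n b m) -> 'cV[R]_d -> 'M[R]_d) : Prop :=
  forall hist x,
    [/\ (oracle hist x)^T = oracle hist x,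
        loewner_le ((Num.sqrt alpha)^-1 *: hess f x) (oracle hist x) &
        loewner_le (oracle hist x) (Num.sqrt alpha *: hess f x)].

Definition svrg_gradient (R : realType) (d n b : nat)
    (psi : 'I_n -> 'cV[R]_d -> R) (f : 'cV[R]_d -> R)
    (xtilde x : 'cV[R]_d) (B : b.-tuple 'I_n) : 'cV[R]_d :=
  b%:R^-1 *: (\sum_(j < b) grad (psi (tnth B j)) x)
  - b%:R^-1 *: (\sum_(j < b) grad (psi (tnth B j)) xtilde)
  + grad f xtilde.

Definition inner_step (R : realType) (d n b : nat)
    (psi : 'I_n -> 'cV[R]_d -> R) (f : 'cV[R]_d -> R) (eta : R)
    (H : 'M[R]_d) (xtilde x : 'cV[R]_d) (B : b.-tuple 'I_n) : 'cV[R]_d :=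
  x - eta *: (invmx H *m svrg_gradient psi f xtilde x B).

Definition outer_step (R : realType) (d n b m : nat)
    (psi : 'I_n -> 'cV[R]_d -> R) (f : 'cV[R]_d -> R) (eta : R)
    (H : 'M[R]_d) (xtilde : 'cV[R]_d) (e : epoch n b m) : 'cV[R]_d :=
  foldl (inner_step psi f eta H xtilde) xtilde e.

(* Outer iterate reached from xtilde by running through the epochs of w, when
   the epochs of hist have already been consumed. *)
Fixpoint mb_svrn_from (R : realType) (d n b m : nat)
    (psi : 'I_n -> 'cV[R]_d -> R) (f : 'cV[R]_d -> R) (eta : R)
    (oracle : seq (epoch n b m) -> 'cV[R]_d -> 'M[R]_d)
    (hist : seq (epoch n b m)) (xtilde : 'cV[R]_d) (w : seq (epoch n b m)) :
    'cV[R]_d :=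
  if w is e :: w' then
    mb_svrn_from psi f eta oracle (rcons hist e)
      (outer_step psi f eta (oracle hist xtilde) xtilde e) w'
  else xtilde.

Definition mb_svrn (R : realType) (d n b m : nat)
    (psi : 'I_n -> 'cV[R]_d -> R) (f : 'cV[R]_d -> R) (eta : R)
    (oracle : seq (epoch n b m) -> 'cV[R]_d -> 'M[R]_d)
    (x0 : 'cV[R]_d) (w : seq (epoch n b m)) : 'cV[R]_d :=
  mb_svrn_from psi f eta oracle [::] x0 w.

(* Uniform probability.  On s.-tuple (epoch n b m) it is the law of s * m * b
   independent uniform draws from 'I_n. *)
Definition counting_prob (R : realType) (Omega : finType) (E : {set Omega}) :
    R :=
  #|E|%:R / #|Omega|%:R.

(* Main.v *)
(* Distances are measured by D(x) = |x - x*|_H^2.  Inside the region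
   D <= (mu^(3/2) / (8 alpha L))^2 one preconditioned gradient step contracts
   D by the factor 1 - a with a = eta / (5 sqrt alpha): I - eta Hhat^-1 H is
   self-adjoint for the H-inner product and the remainder of the linearised
   gradient is of smaller order than 1 / alpha.  By cocoercivity of the convex
   smooth psi_i, the sampling noise of a draw has variance proportional to
   D(x) + D(y), y being the anchor of the outer iteration.

   Concentration comes from moments of order p ~ ln (n / delta).  A second-order
   Taylor bound for t^p, applied to one draw at a time, gives for
   Phi = D + theta D(y) with theta ~ p beta alpha^2 kappa / n
     E Phi(x')^p <= e^(-a p / 2) Phi(x)^p + (8 theta D(y))^p.
   Since 3^p >= 2 n, summing over the n / b inner steps costs only a constant
   factor in the base of the p-th power.  Hence, as long as the iterates stay in
   the region, an outer iteration multiplies the p-th moment of D by at most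
   (24 theta)^p, and it leaves the region with probability at most
   (6 D(y) / Z)^p, where Z is the value of D on the boundary of the region.
   These exit probabilities decay geometrically along the outer iterations, so
   their sum is at most delta for any number s of outer iterations; Markov's
   inequality for D^p at time s accounts for the other delta. *)

Require Import Defs.
From HB Require Import structures.
From mathcomp Require Import all_boot all_order all_algebra.
From mathcomp Require Import all_classical all_reals all_analysis.
From mathcomp Require Import ring lra.

Set Implicit Arguments.
Unset Strict Implicit.
Unset Printing Implicit Defensive.

Import Order.TTheory GRing.Theory Num.Theory.
Import numFieldNormedType.Exports.

Local Open Scope classical_set_scope.
Local Open Scope ring_scope.

(** * Euclidean inner product and directional derivatives *)

Section InnerProduct.
Variables (R : realType) (d : nat).
Implicit Types (u v w : 'cV[R]_d) (A : 'M[R]_d) (a : R).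

Lemma dotvE u v : dotv u v = (u^T *m v) 0 0.
Proof. by rewrite mxE; apply: eq_bigr => i _; rewrite mxE. Qed.

Lemma dotvC u v : dotv u v = dotv v u.
Proof. by apply: eq_bigr => i _; rewrite mulrC. Qed.

Lemma dotvDr u v w : dotv u (v + w) = dotv u v + dotv u w.
Proof. by rewrite !dotvE mulmxDr mxE. Qed.

Lemma dotvDl u v w : dotv (u + v) w = dotv u w + dotv v w.
Proof. by rewrite dotvC dotvDr !(dotvC w). Qed.

Lemma dotvZr a u v : dotv u (a *: v) = a * dotv u v.
Proof. by rewrite !dotvE -scalemxAr mxE. Qed.

Lemma dotvZl a u v : dotv (a *: u) v = a * dotv u v.
Proof. by rewrite dotvC dotvZr dotvC. Qed.

Lemma dotvNr u v : dotv u (- v) = - dotv u v.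
Proof. by rewrite -scaleN1r dotvZr mulN1r. Qed.

Lemma dotvNl u v : dotv (- u) v = - dotv u v.
Proof. by rewrite dotvC dotvNr dotvC. Qed.

Lemma dotv0r u : dotv u 0 = 0.
Proof. by rewrite dotvE mulmx0 mxE. Qed.

Lemma dotv0l u : dotv 0 u = 0.
Proof. by rewrite dotvC dotv0r. Qed.

Lemma dotv_sumr (I : Type) (r : seq I) u (F : I -> 'cV[R]_d) :
  dotv u (\sum_(i <- r) F i) = \sum_(i <- r) dotv u (F i).
Proof.
by elim/big_rec2: _ => [|i x y _ <-]; rewrite ?dotv0r // dotvDr.
Qed.

Lemma dotv_mulmx A u v : dotv u (A *m v) = dotv (A^T *m u) v.
Proof. by rewrite !dotvE trmx_mul trmxK mulmxA. Qed.

Lemma dotvv_ge0 v : 0 <= dotv v v.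
Proof. by apply: sumr_ge0 => i _; rewrite -expr2 sqr_ge0. Qed.

Lemma dotvv_eq0 v : (dotv v v == 0) = (v == 0).
Proof.
apply/idP/eqP => [|->]; last by rewrite dotv0r.
rewrite psumr_eq0 => [/allP h|i _]; last by rewrite -expr2 sqr_ge0.
apply/colP => i; rewrite mxE; apply/eqP.
by have := h i (mem_index_enum i); rewrite /= mulf_eq0 orbb.
Qed.

Lemma enorm_sqr v : enorm v ^+ 2 = dotv v v.
Proof. by rewrite sqr_sqrtr ?dotvv_ge0. Qed.

Lemma enorm_ge0 v : 0 <= enorm v.
Proof. exact: sqrtr_ge0. Qed.

Lemma enorm_eq0 v : (enorm v == 0) = (v == 0).
Proof. by rewrite -sqrf_eq0 enorm_sqr dotvv_eq0. Qed.

Lemma enormZ a v : enorm (a *: v) = `|a| * enorm v.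
Proof.
by rewrite /enorm dotvZl dotvZr mulrA -expr2 sqrtrM ?sqr_ge0 // sqrtr_sqr.
Qed.

(** The form at [u + t *: v] is a nonnegative quadratic in [t]; it is evaluated at its minimiser
    [- b / c]. If [c = 0] it is affine, and a slope [b <> 0] would let it reach [- 1]. *)
Lemma mxform_cauchy_schwarz A : A^T = A ->
  (forall v, 0 <= dotv v (A *m v)) ->
  forall u v, dotv u (A *m v) ^+ 2 <= dotv u (A *m u) * dotv v (A *m v).
Proof.
move=> symA psdA u v.
have symd : dotv v (A *m u) = dotv u (A *m v) by rewrite dotv_mulmx symA dotvC.
set a := dotv u (A *m u); set c := dotv v (A *m v); set b := dotv u (A *m v).
have q t : 0 <= a + 2 * t * b + t ^+ 2 * c.
  have := psdA (u + t *: v); rewrite mulmxDr -scalemxAr !(dotvDl, dotvDr).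
  by rewrite !(dotvZl, dotvZr) symd -/a -/b -/c => h; nra.
have a0 : 0 <= a by exact: psdA.
have : 0 <= c by exact: psdA.
rewrite le_eqVlt => /predU1P[c0|c0].
  have [->|b0] := eqVneq b 0; first by rewrite -c0 mulr0 expr0n.
  have := q (- (a + 1) / (2 * b)); rewrite -c0.
  have -> : a + 2 * (- (a + 1) / (2 * b)) * b
    + (- (a + 1) / (2 * b)) ^+ 2 * 0 = - 1 by field.
  lra.
have := q (- (b / c)).
have -> : a + 2 * - (b / c) * b + (- (b / c)) ^+ 2 * c = (a * c - b ^+ 2) / c.
  by field; rewrite gt_eqF.
by rewrite pmulr_lge0 ?invr_gt0 // subr_ge0.
Qed.

Lemma dotv_sqr_le u v : dotv u v ^+ 2 <= dotv u u * dotv v v.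
Proof.
have psd1 (w : 'cV[R]_d) : 0 <= dotv w (1%:M *m w).
  by rewrite mul1mx dotvv_ge0.
by have := mxform_cauchy_schwarz (trmx1 _ _) psd1 u v; rewrite !mul1mx.
Qed.

Lemma normr_dotv_le u v : `|dotv u v| <= enorm u * enorm v.
Proof.
rewrite -sqrtrM ?dotvv_ge0 // -sqrtr_sqr ler_wsqrtr //; exact: dotv_sqr_le.
Qed.

Lemma enormD_le u v : enorm (u + v) <= enorm u + enorm v.
Proof.
rewrite -(@ler_pXn2r _ 2) ?nnegrE ?addr_ge0 ?enorm_ge0 // enorm_sqr.
have := ler_norm (dotv u v); have := normr_dotv_le u v.
have := enorm_sqr u; have := enorm_sqr v.
by rewrite !(dotvDl, dotvDr) (dotvC v u) => <- <- h1 h2; nra.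
Qed.

Lemma dotvvB_le u v : dotv (u - v) (u - v) <= 2 * dotv u u + 2 * dotv v v.
Proof.
have := dotvv_ge0 (u + v).
rewrite !(dotvDl, dotvDr, dotvNl, dotvNr) (dotvC v u); lra.
Qed.

(** Makes [spectral_norm] a genuine supremum, since [sup] takes the default value 0 on an unbounded
    set. The Euclidean norm is at most the sum of the absolute values of the coordinates. *)
Lemma spectral_norm_bound A :
  has_ubound [set enorm (A *m v) | v in [set v : 'cV[R]_d | enorm v <= 1]].
Proof.
exists (\sum_(i < d) \sum_(j < d) `|A i j|) => _ [v /= v1 <-].
have vj j : `|v j 0| <= 1.
  apply: le_trans v1.
  rewrite -(@ler_pXn2r _ 2) ?nnegrE ?enorm_ge0 // enorm_sqr real_normK ?num_real //.
  rewrite /dotv (bigD1 j) //= -expr2 lerDl; apply: sumr_ge0 => i _.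
  by rewrite -expr2 sqr_ge0.
have l1 w : enorm w <= \sum_i `|w i 0|.
  rewrite -(@ler_pXn2r _ 2) ?nnegrE ?enorm_ge0 ?sumr_ge0 // enorm_sqr expr2.
  rewrite mulr_suml; apply: ler_sum => i _.
  rewrite (bigD1 i) //= mulrDr -normrM.
  apply: (le_trans (ler_norm _)); rewrite lerDl mulr_ge0 //.
  exact: sumr_ge0.
apply: (le_trans (l1 _)); apply: ler_sum => i _; rewrite mxE.
apply: (le_trans (ler_norm_sum _ _ _)); apply: ler_sum => j _.
by rewrite normrM ler_piMr.
Qed.

Lemma enorm_mulmx_le A v : enorm (A *m v) <= spectral_norm A * enorm v.
Proof.
have [->|v0] := eqVneq v 0.
  by rewrite mulmx0 /enorm dotv0r sqrtr0 mulr0.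
have n0 : 0 < enorm v by rewrite lt_neqAle eq_sym enorm_eq0 v0 enorm_ge0.
rewrite -ler_pdivrMr //.
have -> : enorm (A *m v) / enorm v = enorm (A *m ((enorm v)^-1 *: v)).
  by rewrite -scalemxAr enormZ ger0_norm ?invr_ge0 ?enorm_ge0 // mulrC.
apply: ub_le_sup; first exact: spectral_norm_bound.
exists ((enorm v)^-1 *: v) => //=.
by rewrite enormZ ger0_norm ?invr_ge0 ?enorm_ge0 // mulVf // gt_eqF.
Qed.

End InnerProduct.

Section DirectionalDerivatives.
Variables (R : realType) (d : nat).
Implicit Types (g : 'cV[R]_d -> R) (x v w : 'cV[R]_d).

Lemma derive_grad g x v : differentiable g x -> 'D_v g x = dotv (grad g x) v.
Proof.
move=> dg; rewrite deriveE //.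
have vE : v = \sum_(i < d) v i 0 *: delta_mx i 0.
  by rewrite [LHS]matrix_sum_delta; apply: eq_bigr => i _; rewrite big_ord1.
rewrite [in LHS]vE linear_sum /=; apply: eq_bigr => i _.
by rewrite linearZ /= /grad mxE deriveE // mulrC.
Qed.

Lemma is_derive_line g x v (t : R) :
  differentiable g (x + t *: v) ->
  is_derive t 1 (fun s : R => g (x + s *: v)) (dotv (grad g (x + t *: v)) v).
Proof.
move=> dg; rewrite -derive_grad //.
(* The difference quotient of the restriction at [t] in direction 1 is, as a function of [h], that
   of [g] at [x + t *: v] in direction [v]. *)
have E : (fun h : R => h^-1 *: (((fun s : R => g (x + s *: v)) \o shift t) (h *: 1)
    - (fun s : R => g (x + s *: v)) t)) =
  (fun h : R => h^-1 *: ((g \o shift (x + t *: v)) (h *: v) - g (x + t *: v))).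
  apply/funext => h /=; congr (_ *: (g _ - _)).
  by rewrite /shift /= -[h *: 1]/(h * 1) mulr1 scalerDl addrCA.
have dv := @diff_derivable _ _ _ _ _ v dg.
split; first by rewrite /derivable E; exact: dv.
by rewrite /derive E.
Qed.

Lemma mvt_bound (phi dphi : R -> R) (K : R) :
  (forall t : R, is_derive t 1 phi (dphi t)) ->
  (forall t, 0 <= t <= 1 -> `|dphi t| <= K) -> `|phi 1 - phi 0| <= K.
Proof.
move=> dp bd.
have [|c c01 ->] := @MVT_segment R phi dphi 0 1 ler01 (fun t _ => dp t).
  by apply: derivable_within_continuous => t _; have [] := dp t.
by rewrite subr0 mulr1; apply: bd; move: c01; rewrite in_itv.
Qed.

Lemma hess_mulmx (f : 'cV[R]_d -> R) x v (i : 'I_d) :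
  (hess f x *m v) i 0 = dotv (grad (fun y => grad f y i 0) x) v.
Proof. by rewrite mxE; apply: eq_bigr => j _; rewrite !mxE. Qed.

(** Pairing the gradient with a fixed [w] gives a scalar function, to which the one-dimensional mean
    value theorem applies. *)
Lemma is_derive_grad_line (f : 'cV[R]_d -> R) w x v (t : R) :
  (forall y, differentiable (grad f) y) ->
  is_derive t 1 (fun s : R => dotv w (grad f (x + s *: v)))
    (dotv w (hess f (x + t *: v) *m v)).
Proof.
move=> dg.
have -> : (fun s : R => dotv w (grad f (x + s *: v))) =
    \sum_(i < d) (w i 0 \*: (fun s : R => grad f (x + s *: v) i 0)).
  by apply/funext => s; rewrite /dotv fct_sumE.
apply: is_derive_sum => i; apply: is_deriveZ.
rewrite hess_mulmx.
apply: (@is_derive_line (fun y => grad f y i 0)).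
apply: (@differentiable_comp _ _ _ _ (grad f) (fun M : 'cV[R]_d => M i 0)) => //.
exact: differentiable_coord.
Qed.

End DirectionalDerivatives.

(** * Convex smooth functions *)

Section ConvexSmooth.
Variables (R : realType) (d : nat).
Implicit Types (g : 'cV[R]_d -> R) (x y v : 'cV[R]_d).

(** By convexity every difference quotient at [y] towards [x] with [0 < h <= 1] is at most
    [g x - g y]; the derivative is its limit as [h] decreases to 0. *)
Lemma convex_grad_le g x y :
  differentiable g y -> convex_function setT g ->
  g y + dotv (grad g y) (x - y) <= g x.
Proof.
move=> dg cg; rewrite addrC -lerBrDr -derive_grad //.
have dv := @diff_derivable _ _ _ _ _ (x - y) dg.
rewrite /derive cvg_at_rightE //.
apply: limr_le.
  by apply: cvgP; apply: cvg_dnbhs_at_right; exact: dv.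
near=> h.
have h0 : 0 < h by near: h; exact: nbhs_right_gt.
have h1 : h <= 1 by near: h; apply: nbhs_right_le.
have i01 : Itv.spec (@Itv.num_sem R) (Itv.Real `[Posz 0, Posz 1]) h.
  rewrite /= /Itv.num_sem /= num_real /=.
  by rewrite in_itv /= !ltW.
pose t : {i01 R} := Itv.mk i01.
have le : g (h *: x + (1 - h) *: y) <= h * g x + (1 - h) * g y.
  by have := cg t x y; rewrite !inE => /(_ I I).
change (h^-1 * (g (h *: (x - y) + y) - g y) <= g x - g y).
rewrite mulrC ler_pdivrMr // lerBlDr.
have -> : h *: (x - y) + y = h *: x + (1 - h) *: y.
  by apply/colP => i; rewrite !mxE; ring.
by apply: (le_trans le); lra.
Unshelve. all: by end_near.
Qed.

(** With [G] the difference of the gradients, [g] is compared at the point [x - lambda^-1 *: G]: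
    convexity at [y] bounds it from below, smoothness at [x] from above. *)
Lemma cocoercive (lambda : R) g x y : 0 < lambda ->
  (forall z, differentiable g z) -> convex_function setT g -> smooth lambda g ->
  dotv (grad g x - grad g y) (grad g x - grad g y)
    <= 2 * lambda * (g x - g y - dotv (grad g y) (x - y)).
Proof.
move=> l0 dg cg sg.
have [G GE] : exists G, G = grad g x - grad g y by eexists.
have GG : dotv (grad g x) G - dotv (grad g y) G = dotv G G.
  by rewrite -dotvNl -dotvDl -GE.
have h1 := convex_grad_le (x - lambda^-1 *: G) (dg y) cg.
have h2 := sg x (x - lambda^-1 *: G).
have [w wE] : exists w, w = x - y by eexists.
have zx : x - lambda^-1 *: G - x = - (lambda^-1 *: G) by rewrite addrAC subrr add0r.
have zy : x - lambda^-1 *: G - y = w - lambda^-1 *: G by rewrite wE addrAC.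
move: h1 h2; rewrite -GE -wE enorm_sqr zx zy.
rewrite !(dotvDr, dotvNr, dotvNl, dotvZr, dotvZl) {wE}.
set a := dotv G G in GG *; set b := dotv (grad g x) G in GG *.
set c := dotv (grad g y) G in GG *.
set e := dotv _ _ => h1 h2.
have : lambda^-1 * a / 2 <= g x - g y - e.
  have E : lambda / 2 * (lambda^-1 * (lambda^-1 * a)) = lambda^-1 * a / 2.
    by field; rewrite gt_eqF.
  move: h2; rewrite opprK E; move: h1; rewrite -{1}GG.
  by have -> : lambda^-1 * a / 2 = lambda^-1 * b / 2 - lambda^-1 * c / 2;
    [rewrite -GG; ring|lra].
move=> /(ler_wpM2l (ltW (mulr_gt0 (ltr0n _ 2) l0))).
suff -> : 2 * lambda * (lambda^-1 * a / 2) = a by [].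
by field; rewrite gt_eqF.
Qed.

Lemma grad_lipschitz (lambda : R) g x y : 0 < lambda ->
  (forall z, differentiable g z) -> convex_function setT g -> smooth lambda g ->
  dotv (grad g x - grad g y) (grad g x - grad g y)
    <= lambda ^+ 2 * dotv (x - y) (x - y).
Proof.
move=> l0 dg cg sg; apply: (le_trans (cocoercive x y l0 dg cg sg)).
have := sg y x; rewrite enorm_sqr; set D := dotv (x - y) _ => h.
have -> : lambda ^+ 2 * D = 2 * lambda * (lambda / 2 * D) by field.
by apply: ler_wpM2l; [rewrite mulr_ge0 ?ltW|lra].
Qed.

End ConvexSmooth.

(** * The local quadratic model *)

Lemma is_derive_mulr_const (R : realType) (c t : R) :
  is_derive t 1 (fun s : R => s * c) c.
Proof.
have := is_deriveZ c (is_derive_id (t : R) 1).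
rewrite [c *: 1]mulr1 (_ : c \*: id = (fun s : R => s * c)) //.
by apply/funext => s; rewrite mulrC.
Qed.

Lemma is_derive_sqr_mulr_const (R : realType) (c t : R) :
  is_derive t 1 (fun s : R => s ^+ 2 * c) (2 * t * c).
Proof.
have := is_deriveM (is_derive_mulr_const c t) (is_derive_mulr_const 1 t).
rewrite (_ : _ * _ = (fun s : R => s ^+ 2 * c)); last first.
  by apply/funext => s; rewrite fctE; ring.
suff -> : (t * c) *: 1 + (t * 1) *: c = 2 * t * c by [].
by change ((t * c) * 1 + (t * 1) * c = 2 * t * c); ring.
Qed.

(** Extracts second-order information from Taylor bounds with cubic remainder: after division by
    [t ^+ 2], a small [t] makes the right-hand side less than a positive [a]. *)
Lemma le0_of_scaling (R : realType) (a K : R) :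
  (forall t : R, 0 < t -> t ^+ 2 * a <= t ^+ 3 * K) -> a <= 0.
Proof.
move=> h; rewrite leNgt; apply/negP => a0.
have K1 : 0 < 2 * (`|K| + 1) by rewrite mulr_gt0 // ltr_wpDl.
have t0 : 0 < a / (2 * (`|K| + 1)) by rewrite divr_gt0.
set t := a / _ in t0.
have : a <= t * K.
  by rewrite -(ler_pM2l (exprn_gt0 2 t0)) mulrA -exprSr; exact: h.
have : t * K <= t * (`|K| + 1).
  by rewrite ler_pM2l // (le_trans (ler_norm K)) // lerDl.
have -> : t * (`|K| + 1) = a / 2.
  by rewrite /t; field; move: K1; rewrite mulrDr; case: ltgtP => //; lra.
lra.
Qed.

Section LocalModel.
Variables (R : realType) (d : nat) (f : 'cV[R]_d -> R) (L : R).
Hypothesis L_ge0 : 0 <= L.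
Hypothesis diff_f : forall x, differentiable f x.
Hypothesis diff_grad : forall x, differentiable (grad f) x.
Hypothesis lip_hess : hessian_lipschitz L f.
Implicit Types (x u v w z : 'cV[R]_d).

Lemma hess_lipschitz_mulmx x y v :
  enorm ((hess f x - hess f y) *m v) <= L * enorm (x - y) * enorm v.
Proof.
apply: (le_trans (enorm_mulmx_le _ _)).
by apply: ler_wpM2r; [exact: enorm_ge0|exact: lip_hess].
Qed.

(** The error [w] is paired with itself, which reduces the vector-valued mean value inequality to a
    scalar one; then one factor [enorm w] is cancelled. *)
Lemma grad_linearization x z :
  enorm (grad f (x + z) - grad f x - hess f x *m z) <= L * enorm z ^+ 2.
Proof.
have [w wE] : exists w, w = grad f (x + z) - grad f x - hess f x *m z.
  by eexists.
pose c := dotv w (hess f x *m z).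
have dphi (t : R) : is_derive t 1
    ((fun s : R => dotv w (grad f (x + s *: z))) - (fun s : R => s * c))
    (dotv w (hess f (x + t *: z) *m z) - c).
  apply: is_deriveB; last exact: is_derive_mulr_const.
  exact: is_derive_grad_line.
have := @mvt_bound _ _ _ (enorm w * (L * enorm z ^+ 2)) dphi.
have bd (t : R) : 0 <= t <= 1 ->
    `|dotv w (hess f (x + t *: z) *m z) - c| <= enorm w * (L * enorm z ^+ 2).
  move=> /andP[t0 t1]; rewrite /c -dotvNr -dotvDr -mulmxBl.
  apply: (le_trans (normr_dotv_le _ _)); apply: ler_wpM2l; first exact: enorm_ge0.
  apply: (le_trans (hess_lipschitz_mulmx _ _ _)).
  rewrite addrAC subrr add0r enormZ ger0_norm // expr2 mulrA.
  apply: ler_wpM2r; first exact: enorm_ge0.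
  by apply: ler_wpM2l => //; apply: ler_piMl => //; exact: enorm_ge0.
move=> /(_ bd).
rewrite !fctE /= mul1r mul0r scale1r scale0r addr0 subr0.
have -> : dotv w (grad f (x + z)) - c - dotv w (grad f x) = enorm w ^+ 2.
  rewrite enorm_sqr.
  transitivity (dotv w (grad f (x + z) - grad f x - hess f x *m z)).
    by rewrite !(dotvDr, dotvNr) addrAC.
  by rewrite -wE.
rewrite ger0_norm ?sqr_ge0 // -wE expr2.
have := enorm_ge0 w; rewrite le_eqVlt => /predU1P[<- _|w0].
  by rewrite mulr_ge0 ?sqr_ge0.
by rewrite ler_pM2l.
Qed.

(** The increment starts at [x + u], but the expansion is centred at [x], so that increments along
    different paths are all expressed through the same Hessian [hess f x]. *)
Lemma taylor_increment x u w :
  `|f (x + u + w) - f (x + u) - dotv (grad f x + hess f x *m u) w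
    - dotv w (hess f x *m w) / 2| <= L * (enorm u + enorm w) ^+ 2 * enorm w.
Proof.
pose c := dotv (grad f x + hess f x *m u) w.
pose e := dotv w (hess f x *m w) / 2.
have dphi (t : R) : is_derive t 1
    ((fun s : R => f (x + u + s *: w)) - (fun s : R => s * c)
     - (fun s : R => s ^+ 2 * e))
    (dotv (grad f (x + u + t *: w)) w - c - 2 * t * e).
  apply: is_deriveB; last exact: is_derive_sqr_mulr_const.
  apply: is_deriveB; last exact: is_derive_mulr_const.
  exact: is_derive_line.
have := @mvt_bound _ _ _ (L * (enorm u + enorm w) ^+ 2 * enorm w) dphi.
have bd (t : R) : 0 <= t <= 1 ->
    `|dotv (grad f (x + u + t *: w)) w - c - 2 * t * e|
    <= L * (enorm u + enorm w) ^+ 2 * enorm w.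
  move=> /andP[t0 t1].
  have -> : dotv (grad f (x + u + t *: w)) w - c - 2 * t * e =
    dotv (grad f (x + (u + t *: w)) - grad f x - hess f x *m (u + t *: w)) w.
    rewrite /c /e mulmxDr -scalemxAr !(dotvDl, dotvNl, dotvZl) (dotvC (_ *m w)) addrA.
    by field.
  apply: (le_trans (normr_dotv_le _ _)); apply: ler_wpM2r.
    exact: enorm_ge0.
  apply: (le_trans (grad_linearization _ _)); apply: ler_wpM2l => //.
  rewrite ler_pXn2r ?nnegrE ?addr_ge0 ?enorm_ge0 //.
  apply: (le_trans (enormD_le _ _)); rewrite lerD2l enormZ ger0_norm //.
  by apply: ler_piMl => //; exact: enorm_ge0.
move=> /(_ bd).
rewrite !fctE /= expr1n expr0n !mul1r !mul0r scale1r scale0r addr0 !subr0.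
set lhs := `|_|; set rhs := `|_|; suff -> : lhs = rhs by [].
by congr (`| _ |); rewrite /c /e; ring.
Qed.

(** Schwarz's theorem: the two broken paths from [x] to [x + t u + t w], through [x + t u] and
    through [x + t w], give the same increment of [f]. Their expansions differ by [t ^+ 2] times the
    asymmetry, up to a remainder of order [t ^+ 3]. *)
Lemma hess_sym x : (hess f x)^T = hess f x.
Proof.
set H := hess f x.
have key u w : dotv (H *m u) w - dotv (H *m w) u <= 0.
  apply: (@le0_of_scaling _ _ (4 * (L * (enorm u + enorm w) ^+ 3))) => t t0.
  have t1 := taylor_increment x (t *: u) (t *: w).
  have t2 := taylor_increment x 0 (t *: u).
  have t3 := taylor_increment x (t *: w) (t *: u).
  have t4 := taylor_increment x 0 (t *: w).
  have n0 : enorm (0 : 'cV[R]_d) = 0 by apply/eqP; rewrite enorm_eq0.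
  have tn : `|t| = t by rewrite ger0_norm // ltW.
  move: t1 t2 t3 t4; rewrite -/H !mulmx0 !addr0 n0 !add0r !enormZ tn.
  rewrite (_ : x + t *: w + t *: u = x + t *: u + t *: w); last by rewrite addrAC.
  rewrite -!scalemxAr !(dotvDl, dotvZl, dotvZr).
  set a := dotv (H *m u) w; set b := dotv (H *m w) u.
  set A := enorm u; set B := enorm w.
  have A0 : 0 <= A by exact: enorm_ge0.
  have B0 : 0 <= B by exact: enorm_ge0.
  have bnd p q : 0 <= p -> p <= A + B -> 0 <= q -> q <= A + B ->
    L * (t * p) ^+ 2 * (t * q) <= t ^+ 3 * (L * (A + B) ^+ 3).
    move=> p0 pA q0 qA.
    have -> : L * (t * p) ^+ 2 * (t * q) = (L * t ^+ 3) * (p ^+ 2 * q) by ring.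
    have -> : t ^+ 3 * (L * (A + B) ^+ 3) = (L * t ^+ 3) * ((A + B) ^+ 2 * (A + B)).
      by ring.
    apply: ler_wpM2l; first by rewrite mulr_ge0 // exprn_ge0 // ltW.
    apply: ler_pM => //; first exact: sqr_ge0.
    by rewrite ler_pXn2r ?nnegrE ?addr_ge0.
  rewrite -!mulrDr.
  move=> /ler_normlP[t1 t1'] /ler_normlP[t2 t2'] /ler_normlP[t3 t3'] /ler_normlP[t4 t4'].
  have h1 := bnd (A + B) B (addr_ge0 A0 B0) (lexx _) B0 ltac:(lra).
  have h2 := bnd A A A0 ltac:(lra) A0 ltac:(lra).
  have h3 := bnd (A + B) A (addr_ge0 A0 B0) (lexx _) A0 ltac:(lra).
  have h4 := bnd B B B0 ltac:(lra) B0 ltac:(lra).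
  rewrite (addrC B A) in t3 t3'.
  move: h1 h2 h3 h4; lra.
have sym u w : dotv (H *m u) w = dotv (H *m w) u.
  by apply/eqP; rewrite eq_le; apply/andP; split; rewrite -subr_le0 key.
apply/matrixP => i j; rewrite mxE.
have dE (k l : 'I_d) : dotv (H *m delta_mx k 0) (delta_mx l 0) = H l k.
  rewrite /dotv (bigD1 l) //= big1 => [|m ml]; last by rewrite [X in _ * X]mxE (negbTE ml) mulr0.
  by rewrite [X in _ * X]mxE !eqxx mulr1 addr0 -colE mxE.
by rewrite -!dE.
Qed.

Lemma hess_ge (mu : R) x v : strongly_convex mu f ->
  mu * dotv v v <= dotv v (hess f x *m v).
Proof.
move=> sc; rewrite -subr_le0.
apply: (@le0_of_scaling _ _ (2 * (L * enorm v ^+ 3))) => t t0.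
have := sc x (x + t *: v); have := taylor_increment x 0 (t *: v).
have n0 : enorm (0 : 'cV[R]_d) = 0 by apply/eqP; rewrite enorm_eq0.
rewrite !mulmx0 !addr0 n0 add0r (addrAC x) subrr add0r enorm_sqr enormZ.
have tn : `|t| = t by rewrite ger0_norm // ltW.
rewrite tn -!scalemxAr !(dotvDl, dotvZl, dotvZr).
move=> /ler_normlP[h1 h2] h3; move: h2 h3; rewrite -!enorm_sqr; lra.
Qed.

End LocalModel.

(** * Inexact Newton steps *)

Section Preconditioner.
Variables (R : realType) (d : nat) (H P : 'M[R]_d) (mu c1 c2 : R).
Hypotheses (mu_gt0 : 0 < mu) (c1_gt0 : 0 < c1) (c2_gt0 : 0 < c2).
Hypotheses (symH : H^T = H) (symP : P^T = P).
Hypothesis H_ge : forall v, mu * dotv v v <= dotv v (H *m v).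
Hypothesis P_ge : forall v, c1 * dotv v (H *m v) <= dotv v (P *m v).
Hypothesis P_le : forall v, dotv v (P *m v) <= c2 * dotv v (H *m v).
Implicit Types (u v w e xi : 'cV[R]_d).
Local Notation Q v := (dotv v (H *m v)).

Lemma Hform_ge0 v : 0 <= Q v.
Proof. by apply: le_trans (H_ge v); rewrite mulr_ge0 ?dotvv_ge0 // ltW. Qed.

Lemma preconditioner_unit : P \in unitmx.
Proof.
rewrite -unitmx_tr -row_free_unit -kermx_eq0; apply/eqP/row_matrixP => i.
set r := row i _; rewrite row0.
have rP : r *m P^T = 0 by rewrite -row_mul mulmx_ker row0.
have : P *m r^T = 0 by rewrite -[P]trmxK -trmx_mul rP trmx0.
move=> P0; have := P_ge r^T; rewrite P0 dotv0r.
have := H_ge r^T; have := dotvv_ge0 r^T => h1 h2 h3.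
have : dotv r^T r^T <= 0.
  rewrite -(ler_pM2l (mulr_gt0 c1_gt0 mu_gt0)) mulr0 -mulrA.
  by apply: le_trans h3; rewrite ler_pM2l.
move=> h4; have : dotv r^T r^T == 0 by rewrite eq_le h4 h1.
by rewrite dotvv_eq0 => /eqP /(congr1 trmx); rewrite trmxK trmx0.
Qed.

(** For [y = P^-1 xi] one has [c1 * Q y <= <y, xi>] and [mu * |y|^2 <= Q y]. Cauchy-Schwarz joins
    the two, and one factor [Q y] cancels. *)
Lemma Hform_precond_le xi : Q (invmx P *m xi) <= dotv xi xi / (c1 ^+ 2 * mu).
Proof.
have [y yE] : exists y, y = invmx P *m xi by eexists.
have Py : P *m y = xi by rewrite yE mulmxA mulmxV ?preconditioner_unit // mul1mx.
rewrite -yE; have h1 := P_ge y; rewrite Py in h1.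
have h2 := dotv_sqr_le y xi; have h3 := H_ge y.
have q0 := Hform_ge0 y; have y0 := dotvv_ge0 y; have x0 := dotvv_ge0 xi.
set q := Q y in h1 h3 q0 *; set s := dotv y xi in h1 h2.
set n := dotv y y in h2 h3 y0; set m := dotv xi xi in h2 x0 *.
rewrite ler_pdivlMr; last by rewrite mulr_gt0 // exprn_gt0.
move: q0; rewrite le_eqVlt => /predU1P[<-|q0]; first by rewrite mul0r.
rewrite -(ler_pM2l q0).
have -> : q * (q * (c1 ^+ 2 * mu)) = mu * (c1 * q) ^+ 2 by ring.
have h4 : (c1 * q) ^+ 2 <= s ^+ 2.
  by rewrite ler_pXn2r ?nnegrE ?mulr_ge0 ?(ltW c1_gt0) ?(ltW q0) // (le_trans _ h1)
    // mulr_ge0 ?ltW.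
apply: (le_trans (ler_wpM2l (ltW mu_gt0) (le_trans h4 h2))).
by rewrite mulrA ler_wpM2r.
Qed.

(** With [y = P^-1 H v] and [b = <y, P y>], the left-hand side is [Q v - 2 eta b + eta^2 Q y]. As
    [eta <= c1], the last term is at most [eta b], and [b >= Q v / c2] finishes. *)
Lemma precond_contraction (eta : R) v : 0 <= eta -> eta <= c1 ->
  Q (v - eta *: (invmx P *m (H *m v))) <= (1 - eta / c2) * Q v.
Proof.
move=> e0 e1; have [y yE] : exists y, y = invmx P *m (H *m v) by eexists.
have Py : P *m y = H *m v.
  by rewrite yE mulmxA mulmxV ?preconditioner_unit // mul1mx.
rewrite -yE; set q := Q v; set b := dotv y (P *m y).
have yv : dotv y (H *m v) = b by rewrite /b Py.
have vy : dotv v (H *m y) = b by rewrite dotv_mulmx symH dotvC.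
have vPy : dotv v (P *m y) = q by rewrite Py.
have yPv : dotv y (P *m v) = q by rewrite dotv_mulmx symP dotvC vPy.
(* This is [P^-1 >= (c2 H)^-1] tested on [H v]; it is read off from nonnegativity of the [P]-form at
   [y - c2^-1 *: v]. *)
have h1 : q / c2 <= b.
  have := P_le v; have := P_ge (y - c2^-1 *: v).
  have := Hform_ge0 (y - c2^-1 *: v) => h /(le_trans (mulr_ge0 (ltW c1_gt0) h)) {h}.
  rewrite !(mulmxDr, mulmxN) -!scalemxAr.
  rewrite !(dotvDl, dotvDr, dotvNl, dotvNr, dotvZl, dotvZr).
  rewrite yPv vPy -/b.
  set p := dotv v (P *m v) => h2 h3.
  have h4 : c2^-1 * (c2^-1 * p) <= q / c2.
    rewrite (mulrC q); apply: ler_wpM2l; first by rewrite invr_ge0 ltW.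
    by rewrite mulrC ler_pdivrMr // mulrC.
  by move: h2 h4; rewrite (mulrC q); lra.
have h2 := P_ge y; rewrite -/b in h2.
rewrite !(mulmxDr, mulmxN) -!scalemxAr.
rewrite !(dotvDl, dotvDr, dotvNl, dotvNr, dotvZl, dotvZr) yv vy -/q.
have qy := Hform_ge0 y.
have : eta * (eta * Q y) <= eta * b.
  apply: ler_wpM2l => //; apply: le_trans h2; exact: ler_wpM2r.
have : eta * (q / c2) <= eta * b by exact: ler_wpM2l.
rewrite mulrBl mul1r (_ : eta / c2 * q = eta * (q / c2)); first lra.
by field; rewrite gt_eqF.
Qed.

(** Here [e] stands for the error of the linearised gradient. Of the gain [eta / c2], the cross term
    between the exact step and [P^-1 e] takes at most one half, and the square of the error one
    sixteenth; this leaves 7/16. *)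
Lemma precond_drift (eta r : R) v e : 0 <= eta -> eta <= c1 -> eta <= c2 ->
  Q (invmx P *m e) <= r ^+ 2 * Q v -> 0 <= r -> r <= 1 / (4 * c2) ->
  Q (v - eta *: (invmx P *m (H *m v + e))) <= (1 - 7 / 16 * (eta / c2)) * Q v.
Proof.
move=> e0 e1 e2 he r0 hr; have := precond_contraction v e0 e1.
rewrite [invmx P *m (_ + _)]mulmxDr scalerDr opprD addrA.
have [u uE] : exists u, u = v - eta *: (invmx P *m (H *m v)) by eexists.
have [w wE] : exists w, w = invmx P *m e by eexists.
rewrite -uE -wE => hu; rewrite -wE in he.
have cs := mxform_cauchy_schwarz symH Hform_ge0 u w.
have wu : dotv w (H *m u) = dotv u (H *m w) by rewrite dotv_mulmx symH dotvC.
rewrite !(mulmxDr, mulmxN) -!scalemxAr.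
rewrite !(dotvDl, dotvDr, dotvNl, dotvNr, dotvZl, dotvZr) wu.
have q0 := Hform_ge0 v; have u0 := Hform_ge0 u; have w0 := Hform_ge0 w.
set q := Q v in he hu q0 *; set U := Q u in hu cs u0 *; set W := Q w in he cs w0 *.
set s := dotv u (H *m w) in cs *.
pose k := c2^-1; have k0 : 0 < k by rewrite invr_gt0.
have ek : eta / c2 <= 1 by rewrite ler_pdivrMr // mul1r.
have ek0 : 0 <= eta / c2 by rewrite divr_ge0 // ltW.
have rk : r <= k / 4.
  by rewrite (_ : k / 4 = 1 / (4 * c2)) // /k; field; rewrite gt_eqF.
have W1 : W <= (k / 4) ^+ 2 * q.
  apply: (le_trans he); apply: ler_wpM2r => //.
  by rewrite ler_pXn2r ?nnegrE // divr_ge0 // ltW.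
have U1 : U <= q.
  apply: (le_trans hu); rewrite ler_piMl //; move: ek0; lra.
have s1 : - s <= k / 4 * q.
  apply: (le_trans (ler_norm _)); rewrite normrN.
  rewrite -(@ler_pXn2r _ 2) ?nnegrE ?mulr_ge0 ?divr_ge0 ?(ltW k0) //.
  rewrite real_normK ?num_real //; apply: (le_trans cs).
  have -> : (k / 4 * q) ^+ 2 = q * ((k / 4) ^+ 2 * q) by ring.
  exact: ler_pM.
have s2 : eta * - s <= eta * (k / 4 * q) by exact: ler_wpM2l.
have W2 : eta * (eta * W) <= eta * (eta * ((k / 4) ^+ 2 * q)).
  by apply: ler_wpM2l => //; apply: ler_wpM2l.
have ekq : (eta * k) * (eta * k * q) <= eta * k * q.
  by rewrite ler_piMl // mulr_ge0.
move: hu s2 W2 ekq; rewrite -/k; lra.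
Qed.

End Preconditioner.

(** * Averages over finite types and killed Markov chains *)

Section FiniteAverage.
Variable R : realType.

Definition avg (T : finType) (F : T -> R) : R := #|T|%:R^-1 * \sum_x F x.

Lemma eq_avg (T : finType) (F G : T -> R) : F =1 G -> avg F = avg G.
Proof. by move=> FG; congr (_ * _); apply: eq_bigr => x _. Qed.

Lemma ler_avg (T : finType) (F G : T -> R) :
  (forall x, F x <= G x) -> avg F <= avg G.
Proof.
by move=> FG; apply: ler_wpM2l; rewrite ?invr_ge0 ?ler0n // ler_sum.
Qed.

Lemma avg_ge0 (T : finType) (F : T -> R) : (forall x, 0 <= F x) -> 0 <= avg F.
Proof. by move=> F0; rewrite mulr_ge0 ?invr_ge0 ?ler0n // sumr_ge0. Qed.

Lemma avgD (T : finType) (F G : T -> R) :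
  avg (fun x => F x + G x) = avg F + avg G.
Proof. by rewrite /avg big_split mulrDr. Qed.

Lemma avgZ (T : finType) (c : R) (F : T -> R) :
  avg (fun x => c * F x) = c * avg F.
Proof. by rewrite /avg -mulr_sumr mulrCA. Qed.

Lemma avg_cst (T : finType) (c : R) : (0 < #|T|)%N -> avg (fun _ : T => c) = c.
Proof.
move=> T0; rewrite /avg sumr_const -[c *+ _]mulr_natl mulrA mulVf ?mul1r //.
by rewrite pnatr_eq0 -lt0n.
Qed.

Lemma avg_tuple0 (T : finType) (F : 0.-tuple T -> R) : avg F = F [tuple].
Proof.
rewrite /avg card_tuple expn0 invr1 mul1r (bigD1 [tuple]) //= big1 ?addr0 //.
by move=> t /eqP []; rewrite tuple0; exact: val_inj.
Qed.

(** Conditioning on the first draw, which is the one consumed first by [foldl]. *)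
Lemma avg_tupleS (T : finType) (k : nat) (F : k.+1.-tuple T -> R) :
  avg F = avg (fun y => avg (fun w : k.-tuple T => F [tuple of y :: w])).
Proof.
rewrite /avg -[in RHS]mulr_sumr !card_tuple expnS natrM invfM -mulrA.
congr (_ * (_ * _)).
rewrite pair_big /=.
rewrite (reindex (fun q : T * k.-tuple T => [tuple of q.1 :: q.2])) //=.
exists (fun t => (thead t, [tuple of behead t])) => [[y w] _|t _] /=.
  by congr pair; apply: val_inj.
by rewrite -tuple_eta.
Qed.

Lemma avg_foldl_geometric (S : Type) (T : finType) (step : S -> T -> S)
    (F : S -> R) (r : R) :
  0 <= r -> (forall x, avg (fun y => F (step x y)) <= r * F x) ->
  forall k x, avg (fun w : k.-tuple T => F (foldl step x w)) <= r ^+ k * F x.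
Proof.
move=> r0 h; elim=> [|k IH] x; first by rewrite avg_tuple0 expr0 mul1r.
rewrite avg_tupleS; apply: (@le_trans _ _ (avg (fun y => r ^+ k * F (step x y)))).
  by apply: ler_avg => y; exact: IH.
rewrite avgZ exprSr -mulrA; apply: ler_wpM2l; first exact: exprn_ge0.
exact: h.
Qed.

End FiniteAverage.

Section KilledChain.
Variables (R : realType) (S : Type) (T : finType) (step : S -> T -> S).
Variables (N : pred S) (Psi : S -> R) (q F : R).
Hypotheses (T_gt0 : (0 < #|T|)%N) (q_ge0 : 0 <= q) (q_le1 : q <= 1).
Hypotheses (F_ge0 : 0 <= F) (Psi_ge0 : forall x, 0 <= Psi x).
Hypothesis drift : forall x, N x -> avg (fun y => Psi (step x y)) <= q * Psi x + F.

(** The path is tested before its first step and after its last one, so survival also places the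
    endpoint in [N]. *)
Fixpoint stays (x : S) (w : seq T) : bool :=
  N x && (if w is y :: w' then stays (step x y) w' else true).

(** The survival indicator restricts the expectation to paths inside [N], where the drift inequality
    holds; since [q <= 1], each of the [k] steps adds at most [F]. *)
Lemma avg_killed_le k x :
  avg (fun w : k.-tuple T => (stays x w)%:R * Psi (foldl step x w))
    <= q ^+ k * Psi x + k%:R * F.
Proof.
elim: k x => [|k IH] x.
  rewrite avg_tuple0 expr0 mul1r mul0r addr0 /= andbT.
  by case: (N x); rewrite ?mul1r // mul0r.
rewrite avg_tupleS /=; case: (boolP (N x)) => Nx /=; last first.
  rewrite (@eq_avg _ _ _ (fun _ => 0)) ?avg_cst //.
    by rewrite addr_ge0 ?mulr_ge0 ?exprn_ge0.
  move=> y; rewrite (@eq_avg _ _ _ (fun _ => 0 * 0)) ?avgZ ?mul0r //.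
  by move=> w; rewrite !mul0r.
apply: (@le_trans _ _ (avg (fun y => q ^+ k * Psi (step x y) + k%:R * F))).
  by apply: ler_avg => y; exact: IH.
rewrite avgD avgZ avg_cst //.
have := ler_wpM2l (exprn_ge0 k q_ge0) (drift Nx).
have : q ^+ k * F <= F by rewrite ler_piMl // exprn_ile1.
by rewrite exprSr -natr1; lra.
Qed.

(** A maximal inequality: [Psi] plus [F] times the number of remaining steps is a supermartingale up
    to the exit from [N], and at the exit it is at least [Z]. *)
Lemma exit_prob_le (Z : R) k x : 0 <= Z -> (forall x, ~~ N x -> Z <= Psi x) ->
  Z * avg (fun w : k.-tuple T => (~~ stays x w)%:R) <= Psi x + k%:R * F.
Proof.
move=> Z0 hZ; elim: k x => [|k IH] x.
  rewrite avg_tuple0 mul0r addr0 /= andbT.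
  by case: (boolP (N x)) => Nx /=; rewrite ?mulr0 // mulr1 hZ.
case: (boolP (N x)) => Nx; last first.
  rewrite (@eq_avg _ _ _ (fun _ => 1)); last first.
    by move=> w /=; case: (tupleP w) => y w' /=; rewrite (negbTE Nx).
  rewrite avg_cst ?card_tuple ?expn_gt0 ?T_gt0 // mulr1.
  by apply: (le_trans (hZ _ Nx)); rewrite lerDl mulr_ge0.
rewrite avg_tupleS -avgZ /= Nx /=.
apply: (@le_trans _ _ (avg (fun y => Psi (step x y) + k%:R * F))).
  by apply: ler_avg => y; exact: IH.
rewrite avgD avg_cst //.
have := drift Nx; have : q * Psi x <= Psi x by rewrite ler_piMl.
by rewrite -natr1; lra.
Qed.

End KilledChain.

(** * Moments of one draw *)

Section MomentStep.
Variable R : realType.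

(** Induction on the exponent: the new remainder is [v] times the old one plus
    [k * u ^+ q.+1 * (v - u) ^+ 2], and [k ^+ 2 + k <= (k + 1) ^+ 2]. *)
Lemma exprn_taylor_le (q : nat) (u v M : R) :
  0 <= u -> u <= M -> 0 <= v -> v <= M ->
  v ^+ q.+2 <= u ^+ q.+2 + q.+2%:R * u ^+ q.+1 * (v - u)
               + q.+2%:R ^+ 2 * M ^+ q * (v - u) ^+ 2.
Proof.
move=> u0 uM v0 vM; have M0 : 0 <= M by exact: le_trans uM.
elim: q => [|q IH].
  by rewrite expr0 expr1; have := sqr_ge0 (v - u); lra.
have step : v ^+ q.+3 - u ^+ q.+3 - q.+3%:R * u ^+ q.+2 * (v - u) =
    v * (v ^+ q.+2 - u ^+ q.+2 - q.+2%:R * u ^+ q.+1 * (v - u))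
    + q.+2%:R * u ^+ q.+1 * (v - u) ^+ 2.
  by rewrite -[q.+3%:R]natr1 !exprS; ring.
set k : R := q.+2%:R in IH step *; have k0 : 0 <= k by rewrite ler0n.
have -> : q.+3%:R = k + 1 :> R by rewrite natr1.
have h1 : v * (v ^+ q.+2 - u ^+ q.+2 - k * u ^+ q.+1 * (v - u)) <=
    M * (k ^+ 2 * M ^+ q * (v - u) ^+ 2).
  apply: (@le_trans _ _ (v * (k ^+ 2 * M ^+ q * (v - u) ^+ 2))).
    by apply: ler_wpM2l => //; move: IH; lra.
  apply: ler_wpM2r => //; apply: mulr_ge0; last exact: sqr_ge0.
  by apply: mulr_ge0; rewrite exprn_ge0.
have h2 : k * u ^+ q.+1 * (v - u) ^+ 2 <= k * M ^+ q.+1 * (v - u) ^+ 2.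
  apply: ler_wpM2r; first exact: sqr_ge0.
  by apply: ler_wpM2l => //; rewrite ler_pXn2r ?nnegrE.
have h3 : 0 <= (k + 1) * M ^+ q.+1 * (v - u) ^+ 2.
  apply: mulr_ge0; last exact: sqr_ge0.
  by apply: mulr_ge0; [rewrite addr_ge0|rewrite exprn_ge0].
move: step h1 h2 h3; rewrite -[q.+3%:R]natr1 -/k (exprS M q); lra.
Qed.

Lemma expR_quarter_le : expR (1 / 4) <= 4 / 3 :> R.
Proof.
have h := expR_ge1Dx (- (1 / 4) : R); rewrite expRN in h.
have e0 := expR_gt0 (1 / 4 : R).
have : expR (1 / 4) * (1 + - (1 / 4)) <= expR (1 / 4) * (expR (1 / 4))^-1 :> R.
  by rewrite ler_pM2l.
by rewrite divff ?gt_eqF //; lra.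
Qed.

(** From [1 - 1/6 <= e^(-1/6)] follows [e <= (6/5)^6 < 3]. *)
Lemma expR1_le3 : expR 1 <= 3 :> R.
Proof.
have h := expR_ge1Dx (- (1 / 6) : R); rewrite expRN in h.
have e0 := expR_gt0 (1 / 6 : R).
have e6 : expR (1 / 6) <= 6 / 5 :> R.
  have : expR (1 / 6) * (1 + - (1 / 6)) <= expR (1 / 6) * (expR (1 / 6))^-1 :> R.
    by rewrite ler_pM2l.
  by rewrite divff ?gt_eqF //; lra.
have -> : (1 : R) = 6%:R * (1 / 6) by field.
rewrite expRM_natl.
have : expR (1 / 6) ^+ 6 <= (6 / 5) ^+ 6 :> R.
  by rewrite ler_pXn2r ?nnegrE ?expR_ge0 //; lra.
by move/le_trans; apply; lra.
Qed.

Lemma exprn_1D3div_le (q k : nat) : (q <= k.+1)%N ->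
  (1 + 3 / k.+1%:R) ^+ q <= 64 :> R.
Proof.
move=> qk; have k0 : 0 < k.+1%:R :> R by rewrite ltr0n.
apply: (@le_trans _ _ (expR (3 / k.+1%:R * q%:R))).
  rewrite expRM_natr; apply: lerXn2r; rewrite ?nnegrE ?expR_ge0 ?expR_ge1Dx //.
apply: (@le_trans _ _ (expR 3)).
  rewrite ler_expR mulrAC ler_pdivrMr // ler_pM2l //.
  by rewrite ler_nat.
have -> : (3 : R) = 3%:R * 1 by rewrite mulr1.
rewrite expRM_natl; apply: (@le_trans _ _ (3 ^+ 3)); last lra.
by rewrite ler_pXn2r ?nnegrE ?expR_ge0 ?expR1_le3.
Qed.

Variables (d : nat) (H : 'M[R]_d).
Hypothesis symH : H^T = H.
Hypothesis psdH : forall v, 0 <= dotv v (H *m v).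
Local Notation Q v := (dotv v (H *m v)).

Lemma HformD (u v : 'cV[R]_d) : Q (u + v) = Q u + 2 * dotv u (H *m v) + Q v.
Proof.
rewrite mulmxDr !(dotvDl, dotvDr).
have -> : dotv v (H *m u) = dotv u (H *m v) by rewrite dotv_mulmx symH dotvC.
lra.
Qed.

Variables (T : finType) (zeta : T -> 'cV[R]_d) (q : nat) (w B2 s2 : R).
Hypotheses (T_gt0 : (0 < #|T|)%N) (w_ge0 : 0 <= w).
Hypothesis zeta_mean : \sum_i zeta i = 0.
Hypothesis zeta_bound : forall i, Q (zeta i) <= B2.
Hypothesis zeta_var : avg (fun i => Q (zeta i)) <= s2.
Local Notation p := q.+2.

(** Taylor expansion of the [p]-th power around [y = Q m + w]. Because the draws are centred, the
    linear term contributes only the mean of [Q (zeta i)]; the assumption on [B2] keeps increments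
    below [3 Y / p], so powers of the endpoint exceed those of [Y] by a bounded factor only. *)
Lemma moment_draw (m : 'cV[R]_d) (Y : R) :
  Q m + w <= Y -> p%:R ^+ 2 * B2 <= Y ->
  avg (fun i => (Q (m + zeta i) + w) ^+ p)
    <= (Q m + w) ^+ p + 641 * p%:R ^+ 2 * Y ^+ q.+1 * s2.
Proof.
move=> yY BY; set y := Q m + w in yY *.
have y0 : 0 <= y by rewrite addr_ge0.
have Y0 : 0 <= Y by exact: le_trans yY.
have p0 : 0 < p%:R :> R by rewrite ltr0n.
have p1 : 1 <= p%:R :> R by rewrite ler1n.
pose h i := 2 * dotv m (H *m zeta i) + Q (zeta i).
have hE i : Q (m + zeta i) + w = y + h i by rewrite HformD /y /h; lra.
have cs i : dotv m (H *m zeta i) ^+ 2 <= Y * Q (zeta i).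
  apply: (le_trans (mxform_cauchy_schwarz symH psdH _ _)).
  apply: ler_wpM2r => //; apply: le_trans yY; by rewrite lerDl.
have BY2 i : Q (zeta i) <= Y / p%:R ^+ 2.
  rewrite ler_pdivlMr ?exprn_gt0 // mulrC; apply: le_trans BY.
  by apply: ler_wpM2l; rewrite ?sqr_ge0.
have dm i : dotv m (H *m zeta i) <= Y / p%:R.
  apply: (le_trans (ler_norm _)).
  rewrite -(@ler_pXn2r _ 2) ?nnegrE ?divr_ge0 // real_normK ?num_real //.
  apply: (le_trans (cs i)); rewrite expr_div_n expr2 -mulrA.
  exact: ler_wpM2l.
have Yp : Y / p%:R ^+ 2 <= Y / p%:R.
  apply: ler_wpM2l => //; rewrite lef_pV2 ?posrE ?exprn_gt0 //.
  by rewrite expr2 ler_peMr // ltW.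
(* The increment is twice a cross term of size at most [Y / p] plus a square of size at most
   [Y / p ^+ 2]; [M] therefore bounds both endpoints. *)
pose M := Y * (1 + 3 / p%:R).
have YM : Y <= M by rewrite /M ler_peMr // lerDl divr_ge0 // ltW.
have vM i : y + h i <= M.
  have := dm i; have := BY2 i; rewrite /h /M mulrDr mulr1 => h1 h2.
  have -> : Y * (3 / p%:R) = 3 * (Y / p%:R) by ring.
  by move: yY Yp h1 h2; move: (Y / p%:R) (Y / _) => a b; lra.
have v0 i : 0 <= y + h i by rewrite -hE addr_ge0.
have Mq : M ^+ q <= 64 * Y ^+ q.
  rewrite /M exprMn mulrC; apply: ler_wpM2r; first exact: exprn_ge0.
  by apply: exprn_1D3div_le; rewrite -addn2 leq_addr.
(* From [(2 c + z)^2 <= 8 c^2 + 2 z^2] with [c^2 <= Y z] and [z <= Y]. Together with the 64 of [Mq]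
   this gives 640; the linear term raises it to 641. *)
have h2 i : h i ^+ 2 <= 10 * Y * Q (zeta i).
  rewrite /h.
  have := cs i; set c := dotv m _ => c2; have := psdH (zeta i).
  have : Q (zeta i) <= Y.
    apply: (le_trans (BY2 i)); rewrite ler_pdivrMr ?exprn_gt0 //.
    by rewrite ler_peMr // exprn_ege1.
  set z := Q (zeta i) in c2 * => zY z0.
  have : z * z <= Y * z by exact: ler_wpM2r.
  have := sqr_ge0 (2 * c - z); move: c2; lra.
have bd i : (Q (m + zeta i) + w) ^+ p <=
   y ^+ p + (p%:R * y ^+ q.+1) * h i + (640 * p%:R ^+ 2 * Y ^+ q.+1) * Q (zeta i).
  rewrite hE.
  have := exprn_taylor_le q y0 (le_trans yY YM) (v0 i) (vM i).
  have -> : y + h i - y = h i by ring.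
  move/le_trans; apply; rewrite lerD2l.
  have -> : 640 * p%:R ^+ 2 * Y ^+ q.+1 * Q (zeta i)
     = p%:R ^+ 2 * ((64 * Y ^+ q) * (10 * Y * Q (zeta i))) by rewrite (exprS Y q); ring.
  rewrite -mulrA; apply: ler_wpM2l; first exact: sqr_ge0.
  have M0 : 0 <= M by exact: le_trans YM.
  by apply: ler_pM => //; [exact: exprn_ge0|exact: sqr_ge0].
have mean_h : avg h = avg (fun i => Q (zeta i)).
  rewrite /h avgD avgZ /avg -dotv_sumr -mulmx_sumr zeta_mean mulmx0 dotv0r.
  by rewrite !mulr0 add0r.
apply: (le_trans (ler_avg bd)); rewrite !avgD !avgZ avg_cst // mean_h.
have zv := zeta_var; set V := avg _ in zv *.
have V0 : 0 <= V by exact: avg_ge0.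
rewrite -addrA lerD2l.
have pY : p%:R * y ^+ q.+1 <= p%:R ^+ 2 * Y ^+ q.+1.
  apply: ler_pM; [exact: ltW|exact: exprn_ge0| |].
    by rewrite expr2 ler_peMr // ltW.
  by rewrite ler_pXn2r ?nnegrE.
have : p%:R * y ^+ q.+1 * V <= p%:R ^+ 2 * Y ^+ q.+1 * V by exact: ler_wpM2r.
have : 641 * p%:R ^+ 2 * Y ^+ q.+1 * V <= 641 * p%:R ^+ 2 * Y ^+ q.+1 * s2.
  apply: ler_wpM2l zv; apply: mulr_ge0; last exact: exprn_ge0.
  by apply: mulr_ge0; [rewrite ler0n|exact: sqr_ge0].
lra.
Qed.

End MomentStep.

(** * Moments of one mini-batch *)

Section MomentBatch.
Variables (R : realType) (d : nat) (H : 'M[R]_d).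
Hypothesis symH : H^T = H.
Hypothesis psdH : forall v, 0 <= dotv v (H *m v).
Local Notation Q v := (dotv v (H *m v)).
Variables (T : finType) (zeta : T -> 'cV[R]_d) (q b : nat) (w B2 s2 D a g : R).
Hypotheses (T_gt0 : (0 < #|T|)%N) (w_ge0 : 0 <= w) (D_ge0 : 0 <= D).
Hypothesis zeta_mean : \sum_i zeta i = 0.
Hypothesis zeta_bound : forall i, Q (zeta i) <= B2.
Hypothesis zeta_var : avg (fun i => Q (zeta i)) <= s2.
Hypotheses (a_ge0 : 0 <= a) (a_le1 : a <= 1) (g_ge0 : 0 <= g).
Local Notation p := q.+2.
Local Notation Phi := (D + w).
Hypothesis B2_le : p%:R ^+ 2 * B2 <= Phi / 4.
Hypothesis s2_le : 4 * 641 * p%:R ^+ 2 * s2 <= g * Phi.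
Hypothesis gb_le : g * b%:R <= p%:R * a / 8.

(* [(Phi / 4) ^+ p] is a floor: below it the bound on a single draw is
   useless, because the increments are only controlled by the potential [Phi]
   at the beginning of the mini-batch. *)
Lemma moment_batch_growth (m0 : 'cV[R]_d) :
  avg (fun B : b.-tuple T =>
    (Q (foldl (fun m i => m + zeta i) m0 B) + w) ^+ p + (Phi / 4) ^+ p)
  <= (1 + g) ^+ b * ((Q m0 + w) ^+ p + (Phi / 4) ^+ p).
Proof.
have Phi0 : 0 <= Phi by rewrite addr_ge0.
apply: (@avg_foldl_geometric _ _ _ (fun m i => m + zeta i)
  (fun m => (Q m + w) ^+ p + (Phi / 4) ^+ p) (1 + g)); first exact: addr_ge0.
move=> m; rewrite avgD avg_cst //.
pose Y := Num.max (Q m + w) (Phi / 4).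
have y0 : 0 <= Q m + w by rewrite addr_ge0.
have Y1 : Q m + w <= Y by rewrite /Y le_max lexx.
have Y2 : Phi / 4 <= Y by rewrite /Y le_max lexx orbT.
have Y0 : 0 <= Y by exact: le_trans Y1.
have h := moment_draw symH psdH T_gt0 w_ge0 zeta_mean zeta_bound zeta_var
  Y1 (le_trans B2_le Y2).
have Yp : Y ^+ p <= (Q m + w) ^+ p + (Phi / 4) ^+ p.
  have h1 : 0 <= (Q m + w) ^+ p by exact: exprn_ge0.
  have h2 : 0 <= (Phi / 4) ^+ p by rewrite exprn_ge0 // divr_ge0.
  have [h3|h3] := leP (Q m + w) (Phi / 4); first by rewrite /Y max_r // lerDr.
  by rewrite /Y max_l ?lerDl // ltW.
have h2 : 641 * p%:R ^+ 2 * Y ^+ q.+1 * s2 <= g * Y ^+ p.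
  have -> : 641 * p%:R ^+ 2 * Y ^+ q.+1 * s2 =
     Y ^+ q.+1 * (4 * 641 * p%:R ^+ 2 * s2 / 4) by field.
  apply: (@le_trans _ _ (Y ^+ q.+1 * (g * (Phi / 4)))).
    apply: ler_wpM2l; first exact: exprn_ge0.
    by rewrite mulrA ler_wpM2r // invr_ge0.
  rewrite mulrCA (exprSr Y q.+1); apply: ler_wpM2l => //.
  by apply: ler_wpM2l => //; exact: exprn_ge0.
have h3 := ler_wpM2l g_ge0 Yp.
by move: h h2 h3; lra.
Qed.

(** The noise of the batch inflates moments by at most [e^(a p / 4)], while the contraction by
    [1 - a] provides [e^(- 3 a p / 4)] whenever [w] is a small part of [Phi]. Otherwise [Phi < 4 w],
    and the additive term covers everything. *)
Lemma moment_batch (m0 : 'cV[R]_d) : Q m0 <= (1 - a) * D ->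
  avg (fun B : b.-tuple T =>
    (Q (foldl (fun m i => m + zeta i) m0 B) + w) ^+ p)
  <= expR (- (a / 2)) ^+ p * Phi ^+ p + (8 * w) ^+ p.
Proof.
move=> hm0; have Phi0 : 0 <= Phi by rewrite addr_ge0.
pose G := (1 + g) ^+ b.
have G1 : 1 <= G by rewrite exprn_ege1 // lerDl.
(* The square is bounded because the moment and the floor together bring the factor
   [2 * G - 1 <= G ^+ 2]. *)
have GG : G ^+ 2 <= expR (a / 4) ^+ p.
  rewrite -expRM_natr -exprM; apply: (@le_trans _ _ (expR g ^+ (b * 2))).
    by apply: lerXn2r; rewrite ?nnegrE ?expR_ge0 ?expR_ge1Dx // addr_ge0.
  by rewrite -expRM_natr ler_expR natrM; move: gb_le; lra.
have h : avg (fun B : b.-tuple T =>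
    (Q (foldl (fun m i => m + zeta i) m0 B) + w) ^+ p)
  <= G * (Q m0 + w) ^+ p + (G - 1) * (Phi / 4) ^+ p.
  have := moment_batch_growth m0.
  by rewrite avgD avg_cst ?card_tuple ?expn_gt0 ?T_gt0 // -/G; lra.
apply: (le_trans h) => {h}.
have y0 : 0 <= Q m0 + w by rewrite addr_ge0.
have q4 : (Phi / 4) ^+ p = (1 / 4) ^+ p * Phi ^+ p.
  by rewrite -exprMn mul1r mulrC.
have GP : 2 * G - 1 <= expR (a / 4) ^+ p.
  apply: le_trans GG; have := sqr_ge0 (G - 1).
  by rewrite sqrrB1 -mulr_natl; lra.
have Php : 0 <= Phi ^+ p by exact: exprn_ge0.
have G10 : 0 <= G - 1 by rewrite subr_ge0.
have G0 : 0 <= G by exact: le_trans G1.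
(* If [4 w <= Phi], then [(1 - a) D + w = (1 - a) Phi + a w] is at most [K * Phi]; as [a <= 1], also
   [K >= 1/4], so the floor [Phi / 4] lies below [K * Phi] too. *)
case: (leP (4 * w) Phi) => hw.
  pose K := 1 - 3 / 4 * a.
  have K4 : 1 / 4 <= K by rewrite /K; move: a_le1; lra.
  have K0 : 0 <= K by apply: le_trans K4.
  have yK : Q m0 + w <= K * Phi.
    have : a * (4 * w) <= a * Phi by exact: ler_wpM2l.
    by rewrite /K; lra.
  have e1 : (Q m0 + w) ^+ p <= K ^+ p * Phi ^+ p.
    by rewrite -exprMn; apply: lerXn2r; rewrite ?nnegrE // mulr_ge0.
  have e2 : (Phi / 4) ^+ p <= K ^+ p * Phi ^+ p.
    rewrite q4; apply: ler_wpM2r => //; apply: lerXn2r; rewrite ?nnegrE //.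
  have e3 : K ^+ p <= expR (- (3 / 4 * a)) ^+ p.
    by apply: lerXn2r; rewrite ?nnegrE ?expR_ge0 // expR_ge1Dx.
  have := ler_wpM2l G0 e1; have := ler_wpM2l G10 e2 => f2 f1.
  apply: (@le_trans _ _ ((2 * G - 1) * (K ^+ p * Phi ^+ p))); first lra.
  apply: (@le_trans _ _ (expR (a / 4) ^+ p * (expR (- (3 / 4 * a)) ^+ p * Phi ^+ p))).
    apply: ler_pM => //; [lra|by rewrite mulr_ge0 // exprn_ge0|].
    exact: ler_wpM2r.
  rewrite mulrA -exprMn -expRD (_ : a / 4 + - (3 / 4 * a) = - (a / 2)); last by field.
  by rewrite lerDl exprn_ge0 // mulr_ge0.
have e1 : (Q m0 + w) ^+ p <= Phi ^+ p.
  apply: lerXn2r; rewrite ?nnegrE // lerD2r (le_trans hm0) // ler_piMl //.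
  by move: a_ge0; lra.
have e2 : (Phi / 4) ^+ p <= Phi ^+ p.
  by apply: lerXn2r; rewrite ?nnegrE //; lra.
have f1 := ler_wpM2l G0 e1; have f2 := ler_wpM2l G10 e2.
apply: (@le_trans _ _ (expR (a / 4) ^+ p * Phi ^+ p)).
  by have := ler_wpM2r Php GP; lra.
have e4 : expR (a / 4) <= 2.
  have : expR (a / 4) <= expR (1 / 4) by rewrite ler_expR; move: a_le1; lra.
  by move/le_trans; apply; apply: (le_trans (expR_quarter_le R)); lra.
apply: (@le_trans _ _ ((8 * w) ^+ p)); last first.
  by rewrite lerDr mulr_ge0 ?exprn_ge0 ?expR_ge0.
rewrite -exprMn; apply: lerXn2r; rewrite ?nnegrE ?mulr_ge0 ?expR_ge0 //.
have -> : 8 * w = 2 * (4 * w) by ring.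
by apply: ler_pM; rewrite ?expR_ge0 // ltW.
Qed.

End MomentBatch.

(** * Sampling noise *)

Section FiniteSum.
Variables (R : realType) (d : nat) (f : 'cV[R]_d -> R).
Variables (n : nat) (psi : 'I_n -> 'cV[R]_d -> R) (lambda : R) (xstar : 'cV[R]_d).
Hypotheses (n_gt0 : (0 < n)%N) (lambda_gt0 : 0 < lambda).
Hypothesis f_avg : forall x, f x = n%:R^-1 * \sum_(i < n) psi i x.
Hypothesis diff_psi : forall i x, differentiable (psi i) x.
Hypothesis convex_psi : forall i, convex_function setT (psi i).
Hypothesis smooth_psi : forall i, smooth lambda (psi i).
Hypothesis f_min : forall x, f xstar <= f x.
Implicit Types x y v : 'cV[R]_d.

Lemma card_ord_gt0 : (0 < #|'I_n|)%N.
Proof. by rewrite card_ord. Qed.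

Lemma f_avgE x : f x = avg (fun i => psi i x).
Proof. by rewrite f_avg /avg card_ord. Qed.

Lemma grad_avg x : grad f x = n%:R^-1 *: \sum_(i < n) grad (psi i) x.
Proof.
apply/colP => k; rewrite !mxE summxE.
have -> : f = n%:R^-1 \*: (\sum_(i < n) psi i).
  by apply/funext => y; rewrite f_avg /= fct_sumE.
have dv (i : 'I_n) := @diff_derivable _ _ _ _ _ (delta_mx k 0) (diff_psi i x).
rewrite deriveZ; last by apply: derivable_sum.
rewrite derive_sum //.
by congr (_ * _); apply: eq_bigr => i _; rewrite mxE.
Qed.

Lemma dotv_grad_avg x v : dotv v (grad f x) = avg (fun i => dotv v (grad (psi i) x)).
Proof. by rewrite grad_avg dotvZr dotv_sumr /avg card_ord. Qed.

Lemma smooth_f : smooth lambda f.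
Proof.
move=> x y; rewrite !f_avgE dotvC dotv_grad_avg.
rewrite -(@avg_cst R 'I_n (lambda / 2 * _)) ?card_ord // -!avgD.
by apply: ler_avg => i; rewrite (dotvC (y - x)); exact: smooth_psi.
Qed.

(** A gradient step of length [lambda^-1] from the minimiser would lower [f] by at least
    [|g|^2 / (2 lambda)]. *)
Lemma grad_min : grad f xstar = 0.
Proof.
set g := grad f xstar.
have := smooth_f xstar (xstar - lambda^-1 *: g); have := f_min (xstar - lambda^-1 *: g).
have -> : xstar - lambda^-1 *: g - xstar = - (lambda^-1 *: g).
  by rewrite addrAC subrr add0r.
rewrite -/g enorm_sqr !(dotvNl, dotvNr) !(dotvZl, dotvZr).
move=> h1 h2.
have : lambda^-1 * dotv g g <= 0.
  have : lambda / 2 * - - (lambda^-1 * (lambda^-1 * dotv g g))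
     = lambda^-1 * dotv g g / 2 by field; rewrite gt_eqF.
  by move: h1 h2; lra.
rewrite pmulr_rle0 ?invr_gt0 // => g0.
by apply/eqP; rewrite -dotvv_eq0 eq_le g0 dotvv_ge0.
Qed.

Definition grad_diff (x y : 'cV[R]_d) (i : 'I_n) : 'cV[R]_d :=
  grad (psi i) x - grad (psi i) y.

(** The centred error of one variance-reduced draw at the iterate [x] with anchor [y]. *)
Definition noise (x y : 'cV[R]_d) (i : 'I_n) : 'cV[R]_d :=
  grad_diff x y i - (grad f x - grad f y).

Lemma sum_grad_diff x y :
  \sum_(i < n) grad_diff x y i = n%:R *: (grad f x - grad f y).
Proof.
rewrite !grad_avg -scalerBr scalerA divff ?scale1r ?sumrB //.
by rewrite pnatr_eq0 -lt0n.
Qed.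

Lemma noise_sum x y : \sum_(i < n) noise x y i = 0.
Proof.
by rewrite sumrB sum_grad_diff sumr_const card_ord -[(_ - _) *+ n]scaler_nat subrr.
Qed.

Lemma noise_dotE x y i : dotv (noise x y i) (noise x y i) =
  dotv (grad_diff x y i) (grad_diff x y i)
  + (- 2 * dotv (grad f x - grad f y) (grad_diff x y i)
     + dotv (grad f x - grad f y) (grad f x - grad f y)).
Proof.
rewrite /noise; move: (grad_diff x y i) (grad f x - _) => u v.
by rewrite !(dotvDl, dotvDr, dotvNl, dotvNr) (dotvC u v); lra.
Qed.

Lemma noise_var x y : avg (fun i => dotv (noise x y i) (noise x y i)) =
  avg (fun i => dotv (grad_diff x y i) (grad_diff x y i))
  - dotv (grad f x - grad f y) (grad f x - grad f y).
Proof.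
rewrite (eq_avg (noise_dotE x y)) !avgD avgZ avg_cst ?card_ord //.
have -> : avg (fun i => dotv (grad f x - grad f y) (grad_diff x y i))
    = dotv (grad f x - grad f y) (grad f x - grad f y).
  rewrite /avg -dotv_sumr sum_grad_diff dotvZr card_ord mulKf //.
  by rewrite pnatr_eq0 -lt0n.
lra.
Qed.

(** The difference is routed through [xstar]. Cocoercivity bounds each half by a Bregman divergence
    of [psi i], and on averaging the linear terms vanish with [grad f xstar]. *)
Lemma grad_diff_var x y :
  avg (fun i => dotv (grad_diff x y i) (grad_diff x y i))
  <= 4 * lambda * (f x - f xstar) + 4 * lambda * (f y - f xstar).
Proof.
have one z : avg (fun i => dotv (grad_diff z xstar i) (grad_diff z xstar i))
    <= 2 * lambda * (f z - f xstar).
  apply: (@le_trans _ _ (avg (fun i => 2 * lambda * (psi i z + (-1 * psi i xstar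
     + -1 * dotv (z - xstar) (grad (psi i) xstar)))))).
    apply: ler_avg => i; have := cocoercive z xstar lambda_gt0 (diff_psi i)
      (@convex_psi i) (@smooth_psi i).
    move/le_trans; apply; rewrite ler_pM2l ?mulr_gt0 // (dotvC (z - xstar)); lra.
  by rewrite avgZ !avgD !avgZ -dotv_grad_avg grad_min dotv0r -!f_avgE mulr0 addr0 mulN1r.
apply: (@le_trans _ _ (avg (fun i =>
    2 * dotv (grad_diff x xstar i) (grad_diff x xstar i)
    + 2 * dotv (grad_diff y xstar i) (grad_diff y xstar i)))).
  apply: ler_avg => i; have -> : grad_diff x y i = grad_diff x xstar i - grad_diff y xstar i.
    by rewrite /grad_diff opprB addrA subrK.
  exact: dotvvB_le.
by rewrite avgD !avgZ; have := one x; have := one y; lra.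
Qed.

Lemma noise_var_le x y : avg (fun i => dotv (noise x y i) (noise x y i)) <=
  4 * lambda * (f x - f xstar) + 4 * lambda * (f y - f xstar).
Proof.
rewrite noise_var; have := grad_diff_var x y.
by have := dotvv_ge0 (grad f x - grad f y); lra.
Qed.

Lemma noise_bound x y i :
  dotv (noise x y i) (noise x y i) <= 4 * lambda ^+ 2 * dotv (x - y) (x - y).
Proof.
have gd j : dotv (grad_diff x y j) (grad_diff x y j)
    <= lambda ^+ 2 * dotv (x - y) (x - y).
  exact: grad_lipschitz.
have m : dotv (grad f x - grad f y) (grad f x - grad f y)
    <= lambda ^+ 2 * dotv (x - y) (x - y).
  (* Nonnegativity of the variance in [noise_var] is Jensen's inequality: the squared norm of the
     mean is at most the mean of the squared norms. *)
  rewrite -(@avg_cst R 'I_n (lambda ^+ 2 * _)) ?card_ord //.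
  apply: le_trans (ler_avg gd); rewrite -subr_ge0 -noise_var.
  by apply: avg_ge0 => j; exact: dotvv_ge0.
apply: (le_trans (dotvvB_le _ _)); have := gd i; move: m; lra.
Qed.

Lemma svrg_gradient_noise (b : nat) y x (B : b.-tuple 'I_n) : (0 < b)%N ->
  svrg_gradient psi f y x B =
  grad f x + b%:R^-1 *: \sum_(j < b) noise x y (tnth B j).
Proof.
move=> b0; have bV : b%:R^-1 * b%:R = 1 :> R by rewrite mulVf // pnatr_eq0 -lt0n.
rewrite /svrg_gradient -scalerBr -sumrB [in RHS]sumrB scalerBr sumr_const card_ord.
rewrite -[(_ - _) *+ b]scaler_nat scalerA bV scale1r opprB addrCA; congr (_ + _).
by rewrite addrC subrK.
Qed.

End FiniteSum.

(** * The region of quadratic behaviour *)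

Section LocalStep.
Variables (R : realType) (d : nat) (f : 'cV[R]_d -> R).
Variables (n : nat) (psi : 'I_n -> 'cV[R]_d -> R).
Variables (lambda mu L alpha : R) (xstar : 'cV[R]_d).
Hypotheses (n_gt0 : (0 < n)%N) (lambda_gt0 : 0 < lambda).
Hypotheses (mu_gt0 : 0 < mu) (L_gt0 : 0 < L) (alpha_ge1 : 1 <= alpha).
Hypothesis f_avg : forall x, f x = n%:R^-1 * \sum_(i < n) psi i x.
Hypothesis f_C2 : twice_continuously_differentiable f.
Hypothesis diff_psi : forall i x, differentiable (psi i) x.
Hypothesis convex_psi : forall i, convex_function setT (psi i).
Hypothesis smooth_psi : forall i, smooth lambda (psi i).
Hypothesis sc_f : strongly_convex mu f.
Hypothesis lip_f : hessian_lipschitz L f.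
Hypothesis f_min : forall x, f xstar <= f x.
Implicit Types x y v : 'cV[R]_d.

Local Notation H := (hess f xstar).
Local Notation Q v := (dotv v (hess f xstar *m v)).
Local Notation sa := (Num.sqrt alpha).

Definition dist2 (x : 'cV[R]_d) : R := Q (x - xstar).

Definition in_region (x : 'cV[R]_d) : bool :=
  L ^+ 2 * (8 * alpha) ^+ 2 * dist2 x <= mu ^+ 3.

Let diff_f : forall x, differentiable f x. Proof. by case: f_C2. Qed.
Let diff_g : forall x, differentiable (grad f) x. Proof. by case: f_C2. Qed.
Let L_ge0 : 0 <= L. Proof. exact: ltW. Qed.
Let grad0 : grad f xstar = 0. Proof. exact: (grad_min n_gt0 lambda_gt0 f_avg). Qed.

Lemma hess_min_sym : H^T = H.
Proof. exact: (hess_sym L_ge0 diff_f diff_g lip_f). Qed.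

Lemma hess_min_ge v : mu * dotv v v <= Q v.
Proof. exact: (hess_ge L_ge0 diff_f diff_g lip_f). Qed.

Lemma hess_min_ge0 v : 0 <= Q v.
Proof. exact: Hform_ge0 mu_gt0 hess_min_ge _. Qed.

Lemma dist2_ge0 x : 0 <= dist2 x.
Proof. exact: hess_min_ge0. Qed.

Lemma sqrt_alpha_ge1 : 1 <= sa.
Proof. by rewrite -sqrtr1 ler_wsqrtr. Qed.

Lemma sqr_sqrt_alpha : sa ^+ 2 = alpha.
Proof. by rewrite sqr_sqrtr // (le_trans ler01). Qed.

(** The factor [alpha] in the radius is kept here: it pays for the condition number of the
    preconditioner in [newton_drift]. *)
Lemma near_radius x : in_region x -> L * enorm (x - xstar) * (8 * alpha) <= mu.
Proof.
rewrite /in_region => h; have a0 : 0 <= alpha by exact: le_trans alpha_ge1.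
have l0 : 0 <= L * enorm (x - xstar) * (8 * alpha).
  by rewrite mulr_ge0 ?mulr_ge0 ?enorm_ge0.
rewrite -(@ler_pXn2r _ 2) ?nnegrE ?(ltW mu_gt0) // -(ler_pM2l mu_gt0) -exprS.
apply: le_trans h; rewrite !exprMn enorm_sqr.
have -> : mu * (L ^+ 2 * dotv (x - xstar) (x - xstar) * (8 ^+ 2 * alpha ^+ 2)) =
  L ^+ 2 * (8 ^+ 2 * alpha ^+ 2) * (mu * dotv (x - xstar) (x - xstar)) by ring.
apply: ler_wpM2l; last exact: hess_min_ge.
by rewrite !mulr_ge0 ?sqr_ge0.
Qed.

Lemma near_radius8 x : in_region x -> L * enorm (x - xstar) <= mu / 8.
Proof.
move/near_radius => h.
have h2 : L * enorm (x - xstar) * 8 <= L * enorm (x - xstar) * (8 * alpha).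
  apply: ler_wpM2l; first by rewrite mulr_ge0 ?enorm_ge0.
  by rewrite ler_peMr.
by move: (le_trans h2 h); lra.
Qed.

(** The quadratic model is [dist2 x / 2]; inside the region the cubic remainder is at most
    [dist2 x / 8]. *)
Lemma near_fval x : in_region x ->
  3 / 8 * dist2 x <= f x - f xstar /\ f x - f xstar <= 5 / 8 * dist2 x.
Proof.
move=> /near_radius8 nx.
have := taylor_increment L_ge0 diff_f diff_g lip_f xstar 0 (x - xstar).
have -> : enorm (0 : 'cV[R]_d) = 0 by apply/eqP; rewrite enorm_eq0.
rewrite !mulmx0 !addr0 grad0 dotv0l add0r subr0 [xstar + _]addrC subrK -/(dist2 x).
have hm := hess_min_ge (x - xstar); rewrite -/(dist2 x) in hm.
move: hm; rewrite -enorm_sqr; set e := enorm _ in nx * => hm.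
have e0 : 0 <= e by exact: enorm_ge0.
have : L * e ^+ 2 * e <= dist2 x / 8.
  have -> : L * e ^+ 2 * e = (L * e) * e ^+ 2 by ring.
  apply: le_trans (ler_wpM2r (sqr_ge0 e) nx) _; move: hm; lra.
by move=> h1 /ler_normlP[h2 h3]; split; move: h1 h2 h3; lra.
Qed.

Lemma near_hess x v : in_region x ->
  7 / 8 * Q v <= dotv v (hess f x *m v) /\ dotv v (hess f x *m v) <= 9 / 8 * Q v.
Proof.
move=> /near_radius8 nx.
have : `|dotv v ((hess f x - H) *m v)| <= 1 / 8 * Q v.
  apply: (le_trans (normr_dotv_le _ _)).
  apply: (@le_trans _ _ (enorm v * (mu / 8 * enorm v))).
    apply: ler_wpM2l; first exact: enorm_ge0.
    apply: (le_trans (hess_lipschitz_mulmx lip_f _ _ _)).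
    by apply: ler_wpM2r => //; exact: enorm_ge0.
  have := hess_min_ge v; rewrite -enorm_sqr; lra.
move: (hess f x) (hess f xstar) => A B.
rewrite mulmxBl dotvDr dotvNr; move: (dotv v (A *m v)) (dotv v (B *m v)) => s t.
by move=> /ler_normlP[h2 h3]; split; move: h2 h3; lra.
Qed.

Lemma noise_var_near x y : in_region x -> in_region y ->
  avg (fun i => dotv (noise f psi x y i) (noise f psi x y i))
  <= 5 / 2 * lambda * (dist2 x + dist2 y).
Proof.
move=> /near_fval[_ fx] /near_fval[_ fy].
apply: le_trans (noise_var_le n_gt0 lambda_gt0 f_avg diff_psi
  convex_psi smooth_psi f_min x y) _.
have := ler_wpM2l (ltW lambda_gt0) fx; have := ler_wpM2l (ltW lambda_gt0) fy; lra.
Qed.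

Lemma noise_bound_near x y i :
  dotv (noise f psi x y i) (noise f psi x y i)
  <= 8 * (lambda ^+ 2 / mu) * (dist2 x + dist2 y).
Proof.
apply: le_trans (noise_bound n_gt0 lambda_gt0 f_avg diff_psi
  convex_psi smooth_psi x y i) _.
have h : dotv (x - y) (x - y) <= 2 * (dist2 x + dist2 y) / mu.
  rewrite ler_pdivlMr //.
  have -> : x - y = (x - xstar) - (y - xstar) by rewrite opprB addrA subrK.
  have := ler_wpM2r (ltW mu_gt0) (dotvvB_le (x - xstar) (y - xstar)).
  have := hess_min_ge (x - xstar); have := hess_min_ge (y - xstar).
  rewrite -/(dist2 x) -/(dist2 y); lra.
have l2 : 0 <= 4 * lambda ^+ 2 by rewrite mulr_ge0 ?sqr_ge0.
have := ler_wpM2l l2 h.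
have -> : 4 * lambda ^+ 2 * (2 * (dist2 x + dist2 y) / mu) =
  8 * (lambda ^+ 2 / mu) * (dist2 x + dist2 y) by ring.
by [].
Qed.

(** * Preconditioning by an oracle answer at an anchor inside the region *)

Section Oracle.
Variables (P : 'M[R]_d) (y : 'cV[R]_d).
Hypotheses (near_y : in_region y) (symP : P^T = P).
Hypothesis P_lower : loewner_le (sa^-1 *: hess f y) P.
Hypothesis P_upper : loewner_le P (sa *: hess f y).

(** The factors [sa^-1] and [sa] of the oracle at the anchor, times the 7/8 and 9/8 of [near_hess],
    compare [P] with the Hessian at [xstar]. *)
Let c1 : R := 7 / (8 * sa).
Let c2 : R := 9 * sa / 8.

Let sa_gt0 : 0 < sa. Proof. exact: lt_le_trans sqrt_alpha_ge1. Qed.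
Let c1_gt0 : 0 < c1. Proof. by rewrite divr_gt0 ?mulr_gt0. Qed.
Let c2_gt0 : 0 < c2. Proof. by rewrite divr_gt0 ?mulr_gt0. Qed.

Let P_ge v : c1 * Q v <= dotv v (P *m v).
Proof.
apply: le_trans (P_lower v); rewrite -scalemxAl dotvZr.
have [h _] := near_hess v near_y.
have -> : c1 * Q v = sa^-1 * (7 / 8 * Q v).
  by rewrite /c1; field; rewrite gt_eqF.
by apply: ler_wpM2l h; rewrite invr_ge0 ltW.
Qed.

Let P_le v : dotv v (P *m v) <= c2 * Q v.
Proof.
apply: (le_trans (P_upper v)); rewrite -scalemxAl dotvZr.
have [_ h] := near_hess v near_y.
have -> : c2 * Q v = sa * (9 / 8 * Q v) by rewrite /c2; ring.
by apply: ler_wpM2l h; rewrite ltW.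
Qed.

Lemma oracle_precond_le v : Q (invmx P *m v) <= 64 / 49 * (alpha / mu) * dotv v v.
Proof.
apply: (le_trans (Hform_precond_le mu_gt0 c1_gt0 hess_min_ge P_ge v)).
have -> : (dotv v v / (c1 ^+ 2 * mu)) = 64 / 49 * (sa ^+ 2 / mu) * dotv v v.
  by rewrite /c1; field; rewrite !gt_eqF.
by rewrite sqr_sqrt_alpha.
Qed.

Lemma newton_drift (eta : R) x : in_region x -> 0 <= eta -> eta <= 7 / (8 * sa) ->
  Q (x - xstar - eta *: (invmx P *m grad f x)) <= (1 - eta / (5 * sa)) * dist2 x.
Proof.
move=> nx e0 e1.
pose e := grad f x - H *m (x - xstar).
have -> : grad f x = H *m (x - xstar) + e by rewrite addrC subrK.
have es : enorm e <= L * enorm (x - xstar) ^+ 2.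
  have := grad_linearization L_ge0 diff_g lip_f xstar (x - xstar).
  by rewrite [xstar + _]addrC subrK grad0 subr0.
have sa1 := sqrt_alpha_ge1.
have e2 : eta <= c2.
  apply: (le_trans e1); rewrite ler_pdivrMr ?mulr_gt0 // /c2.
  have := ler_pM ler01 ler01 sa1 sa1; lra.
(* [r ^+ 2] is the product of [64 / 49 * (alpha / mu)] from [oracle_precond_le] and
   [mu / (64 * alpha ^+ 2)] from the radius of the region; moreover [1/7 <= 2/9] yields
   [r <= 1 / (4 * c2)]. *)
pose r : R := 1 / (7 * sa).
have he : Q (invmx P *m e) <= r ^+ 2 * Q (x - xstar).
  apply: (le_trans (oracle_precond_le e)).
  have hm := hess_min_ge (x - xstar).
  have n1 := near_radius nx.
  rewrite -enorm_sqr in hm; rewrite -enorm_sqr.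
  move: (enorm_ge0 (x - xstar)) (enorm_ge0 e) hm es n1.
  move: (enorm (x - xstar)) (enorm e) (Q _) => t u D t0 u0 hm es n1.
  have a0 : 0 < alpha by exact: lt_le_trans alpha_ge1.
  have n2 : L * t ^+ 2 <= mu / (8 * alpha) * t.
    rewrite expr2 mulrA; apply: ler_wpM2r => //.
    by rewrite ler_pdivlMr ?mulr_gt0.
  have n3 : u ^+ 2 <= (mu / (8 * alpha) * t) ^+ 2.
    rewrite ler_pXn2r ?nnegrE //; first exact: le_trans n2.
    exact: le_trans (le_trans es n2).
  have -> : r ^+ 2 * D = 64 / 49 * (alpha / mu) * (mu / (64 * alpha ^+ 2) * D).
    rewrite /r expr_div_n exprMn sqr_sqrt_alpha; field.
    by rewrite !gt_eqF.
  apply: ler_wpM2l; first by rewrite mulr_ge0 ?divr_ge0 // ltW.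
  apply: (le_trans n3).
  have -> : (mu / (8 * alpha) * t) ^+ 2 = mu / (64 * alpha ^+ 2) * (mu * t ^+ 2).
    by field; rewrite gt_eqF.
  apply: ler_wpM2l hm; rewrite divr_ge0 ?(ltW mu_gt0) // mulr_ge0 //.
  exact: sqr_ge0.
have r0 : 0 <= r by rewrite divr_ge0 // mulr_ge0 // ltW.
have r1 : r <= 1 / (4 * c2).
  rewrite /r /c2 !div1r lef_pV2 ?posrE ?mulr_gt0 ?invr_gt0 //.
  by move: sa_gt0; lra.
apply: (le_trans (precond_drift mu_gt0 c1_gt0 c2_gt0 hess_min_sym symP
   hess_min_ge P_ge P_le e0 e1 e2 he r0 r1)).
apply: ler_wpM2r; first exact: dist2_ge0.
(* The rate 7/18 is rounded down to 1/5. *)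
have -> : 7 / 16 * (eta / c2) = 7 / 18 * (eta / sa).
  by rewrite /c2; field; rewrite gt_eqF.
have -> : eta / (5 * sa) = 1 / 5 * (eta / sa) by field; rewrite gt_eqF.
have : 0 <= eta / sa by rewrite divr_ge0 // ltW.
lra.
Qed.

End Oracle.
End LocalStep.

(** * One inner iteration *)

Section SvrnStep.
Variables (R : realType) (d : nat) (f : 'cV[R]_d -> R).
Variables (n : nat) (psi : 'I_n -> 'cV[R]_d -> R).
Variables (lambda mu L alpha : R) (xstar : 'cV[R]_d).
Hypotheses (n_gt0 : (0 < n)%N) (lambda_gt0 : 0 < lambda).
Hypotheses (mu_gt0 : 0 < mu) (L_gt0 : 0 < L) (alpha_ge1 : 1 <= alpha).
Hypothesis f_avg : forall x, f x = n%:R^-1 * \sum_(i < n) psi i x.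
Hypothesis f_C2 : twice_continuously_differentiable f.
Hypothesis diff_psi : forall i x, differentiable (psi i) x.
Hypothesis convex_psi : forall i, convex_function setT (psi i).
Hypothesis smooth_psi : forall i, smooth lambda (psi i).
Hypothesis sc_f : strongly_convex mu f.
Hypothesis lip_f : hessian_lipschitz L f.
Hypothesis f_min : forall x, f xstar <= f x.
Implicit Types x y v : 'cV[R]_d.

Local Notation Q v := (dotv v (hess f xstar *m v)).
Local Notation sa := (Num.sqrt alpha).
Local Notation dist2 := (dist2 f xstar).
Local Notation in_region := (in_region f mu L alpha xstar).
Local Notation kappa := (lambda / mu).

(* [beta], [theta] and [p = q.+2] are the parameters of the moment argument:
   [p] is of order [ln (n / delta)], and [theta] is, up to a constant, the
   contraction factor of one outer iteration. *)
Variables (q b : nat) (beta theta : R).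
Local Notation p := q.+2.
Local Notation eta := (b%:R * sa * beta / n%:R).
Local Notation a := (b%:R * beta / (5 * n%:R)).
Hypotheses (b_gt0 : (0 < b)%N) (beta_ge0 : 0 <= beta).
Hypotheses (theta_gt0 : 0 < theta) (theta_le1 : theta <= 1).
Hypothesis eta_le : eta * sa <= 7 / 8.
Hypothesis theta_max :
  48 * p%:R ^+ 2 * (alpha * kappa * beta / n%:R) ^+ 2 <= theta.
Hypothesis theta_var :
  5 * 10 ^+ 5 * p%:R * (alpha ^+ 2 * kappa * beta / n%:R) <= theta.

Let sa_ge1 : 1 <= sa. Proof. exact: sqrt_alpha_ge1. Qed.
Let sa_gt0 : 0 < sa. Proof. exact: lt_le_trans sa_ge1. Qed.
Let alpha_gt0 : 0 < alpha. Proof. exact: lt_le_trans alpha_ge1. Qed.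
Let nR_gt0 : 0 < n%:R :> R. Proof. by rewrite ltr0n. Qed.
Let bR_gt0 : 0 < b%:R :> R. Proof. by rewrite ltr0n. Qed.
Let kappa_gt0 : 0 < kappa. Proof. by rewrite divr_gt0. Qed.
Let saE : sa ^+ 2 = alpha. Proof. exact: sqr_sqrt_alpha. Qed.
Let hsym : (hess f xstar)^T = hess f xstar.
Proof. exact: (hess_min_sym xstar L_gt0 f_C2 lip_f). Qed.
Let hge v : mu * dotv v v <= Q v.
Proof. exact: (hess_min_ge xstar L_gt0 f_C2 sc_f lip_f). Qed.
Let hge0 v : 0 <= Q v.
Proof. exact: Hform_ge0 mu_gt0 hge v. Qed.
Let d2_ge0 x : 0 <= dist2 x. Proof. exact: hge0. Qed.

Section InnerLoop.
Variables (P : 'M[R]_d) (y : 'cV[R]_d).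
Hypotheses (near_y : in_region y) (symP : P^T = P).
Hypothesis P_lower : loewner_le (sa^-1 *: hess f y) P.
Hypothesis P_upper : loewner_le P (sa *: hess f y).
Local Notation h := (sa * beta / n%:R).

Let h_sqr : h ^+ 2 = alpha * (beta / n%:R) ^+ 2.
Proof. by rewrite -mulrA exprMn saE. Qed.

(** The displacement caused by a single draw: [h] is [eta / b], the batch mean being split into its
    [b] terms. *)
Definition draw_shift x (i : 'I_n) : 'cV[R]_d :=
  - h *: (invmx P *m noise f psi x y i).

(** Presents an inner step as the exact preconditioned gradient step followed by [b] centred
    displacements added one at a time, the form treated by [moment_batch]. *)
Lemma inner_step_foldl x (B : b.-tuple 'I_n) :
  inner_step psi f eta P y x B - xstar =
  foldl (fun m i => m + draw_shift x i)
    (x - xstar - eta *: (invmx P *m grad f x)) B.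
Proof.
have foldE (s : seq 'I_n) (m : 'cV[R]_d) (F : 'I_n -> 'cV[R]_d) :
    foldl (fun m i => m + F i) m s = m + \sum_(i <- s) F i.
  elim: s m => [|i s IH] m; first by rewrite big_nil addr0.
  by rewrite /= IH big_cons addrA.
have -> : foldl (fun m i => m + draw_shift x i)
    (x - xstar - eta *: (invmx P *m grad f x)) B
  = x - xstar - eta *: (invmx P *m grad f x)
    - eta *: (invmx P *m (b%:R^-1 *: \sum_(j < b) noise f psi x y (tnth B j))).
  rewrite foldE; congr (_ + _); rewrite /draw_shift -scaler_sumr -mulmx_sumr.
  rewrite big_tuple -scalemxAr scalerA scaleNr; congr (- (_ *: _)).
  by field; rewrite !gt_eqF.
rewrite /inner_step (svrg_gradient_noise f psi) // mulmxDr scalerDr opprD.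
move: (eta *: (_ *m grad f x)) (eta *: (_ *m (_ *: _))) => u v.
by apply/colP => k; rewrite !mxE; ring.
Qed.

Lemma draw_shift_form x i : Q (draw_shift x i)
  = h ^+ 2 * Q (invmx P *m noise f psi x y i).
Proof.
rewrite /draw_shift; move: (invmx P *m _) (hess f xstar) => v A.
by rewrite -scalemxAr dotvZl dotvZr; ring.
Qed.

Lemma draw_shift_bound x i : Q (draw_shift x i)
  <= 12 * (alpha * kappa * beta / n%:R) ^+ 2 * (dist2 x + dist2 y).
Proof.
rewrite draw_shift_form.
have hp : Q (invmx P *m noise f psi x y i)
    <= 64 / 49 * (alpha / mu) * dotv (noise f psi x y i) (noise f psi x y i).
  exact: (oracle_precond_le mu_gt0 L_gt0 alpha_ge1 f_C2 sc_f lip_f near_y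
    P_lower).
have hn : dotv (noise f psi x y i) (noise f psi x y i)
    <= 8 * (lambda ^+ 2 / mu) * (dist2 x + dist2 y).
  exact: (noise_bound_near xstar n_gt0 lambda_gt0 mu_gt0 L_gt0).
have c0 : 0 <= 64 / 49 * (alpha / mu) by rewrite mulr_ge0 // divr_ge0 // ltW.
have S0 : 0 <= dist2 x + dist2 y by rewrite addr_ge0 ?d2_ge0.
move: hp hn; move: (dist2 x + dist2 y) S0 (Q _) (dotv (noise _ _ _ _ _) _).
move=> S S0 Z E hp hn.
apply: le_trans (ler_wpM2l (sqr_ge0 h) (le_trans hp (ler_wpM2l c0 hn))) _.
have -> : h ^+ 2 * (64 / 49 * (alpha / mu) * (8 * (lambda ^+ 2 / mu) * S))
   = 512 / 49 * (alpha * kappa * beta / n%:R) ^+ 2 * S.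
  by rewrite h_sqr; field; rewrite !gt_eqF.
apply: ler_wpM2r => //; apply: ler_wpM2r; first exact: sqr_ge0.
lra.
Qed.

Lemma draw_shift_var x : in_region x -> avg (fun i => Q (draw_shift x i))
  <= 4 * (alpha ^+ 2 * kappa * beta ^+ 2 / n%:R ^+ 2) * (dist2 x + dist2 y).
Proof.
move=> near_x.
have hn : avg (fun i => dotv (noise f psi x y i) (noise f psi x y i))
    <= 5 / 2 * lambda * (dist2 x + dist2 y).
  exact: (noise_var_near n_gt0 lambda_gt0 mu_gt0 L_gt0 alpha_ge1).
have c0 : 0 <= 64 / 49 * (alpha / mu) by rewrite mulr_ge0 // divr_ge0 // ltW.
have S0 : 0 <= dist2 x + dist2 y by rewrite addr_ge0 ?d2_ge0.
apply: (@le_trans _ _ (avg (fun i => h ^+ 2 * (64 / 49 * (alpha / mu)) *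
    dotv (noise f psi x y i) (noise f psi x y i)))).
  apply: ler_avg => i; rewrite draw_shift_form -[leRHS]mulrA.
  apply: ler_wpM2l; first exact: sqr_ge0.
  exact: (oracle_precond_le mu_gt0 L_gt0 alpha_ge1 f_C2 sc_f lip_f near_y
    P_lower).
rewrite avgZ; move: hn; move: (avg _) (dist2 x + dist2 y) S0 => V S S0 hn.
apply: le_trans (ler_wpM2l (mulr_ge0 (sqr_ge0 h) c0) hn) _.
have -> : h ^+ 2 * (64 / 49 * (alpha / mu)) * (5 / 2 * lambda * S)
   = 160 / 49 * (alpha ^+ 2 * kappa * beta ^+ 2 / n%:R ^+ 2) * S.
  by rewrite h_sqr; field; rewrite !gt_eqF.
apply: ler_wpM2r => //; apply: ler_wpM2r; last lra.
by rewrite divr_ge0 ?sqr_ge0 // mulr_ge0 ?sqr_ge0 // mulr_ge0 ?sqr_ge0 // ltW.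
Qed.

Lemma draw_shift_sum x : \sum_i draw_shift x i = 0.
Proof.
rewrite /draw_shift -scaler_sumr -mulmx_sumr.
by rewrite (noise_sum n_gt0 f_avg diff_psi) mulmx0 scaler0.
Qed.

Lemma inner_step_moment x : in_region x ->
  avg (fun B : b.-tuple 'I_n =>
    (dist2 (inner_step psi f eta P y x B) + theta * dist2 y) ^+ p)
  <= expR (- (a / 2)) ^+ p * (dist2 x + theta * dist2 y) ^+ p
     + (8 * (theta * dist2 y)) ^+ p.
Proof.
move=> near_x.
pose K := alpha ^+ 2 * kappa * beta ^+ 2 / n%:R ^+ 2.
have K0 : 0 <= K.
  by rewrite divr_ge0 ?sqr_ge0 // mulr_ge0 ?sqr_ge0 // mulr_ge0 ?sqr_ge0 // ltW.
(* The growth rate per draw, chosen so that [s2le] is an equality once [Phi] is replaced by its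
   lower bound [theta * (dist2 x + dist2 y)]. *)
pose g := 16 * 641 * p%:R ^+ 2 * K / theta.
have D0 := d2_ge0 x; have E0 := d2_ge0 y.
have w0 : 0 <= theta * dist2 y by rewrite mulr_ge0 // ltW.
have Phi : theta * (dist2 x + dist2 y) <= dist2 x + theta * dist2 y.
  by rewrite mulrDr lerD2r ler_piMl.
have c641 : (0 : R) <= 16 * 641 by rewrite -natrM ler0n.
have g0 : 0 <= g.
  apply: divr_ge0; last exact: ltW.
  exact: (mulr_ge0 (mulr_ge0 c641 (sqr_ge0 _)) K0).
have a0 : 0 <= a by rewrite divr_ge0 ?mulr_ge0 // ltW // mulr_gt0.
have t0 : 0 <= b%:R * beta / n%:R by rewrite divr_ge0 ?mulr_ge0 // ltW.
have a1 : a <= 1.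
  have : b%:R * beta / n%:R <= 7 / 8.
    apply: le_trans eta_le.
    have -> : eta * sa = b%:R * beta / n%:R * sa ^+ 2 by ring.
    by rewrite saE ler_peMr.
  have -> : a = 1 / 5 * (b%:R * beta / n%:R) by field; rewrite gt_eqF.
  lra.
have eta0 : 0 <= eta.
  have -> : eta = b%:R * beta / n%:R * sa by ring.
  by rewrite mulr_ge0 // ltW.
have eta1 : eta <= 7 / (8 * sa).
  rewrite ler_pdivlMr ?mulr_gt0 //.
  by move: eta_le; move: eta => e; lra.
have hm : Q (x - xstar - eta *: (invmx P *m grad f x)) <= (1 - a) * dist2 x.
  have -> : a = eta / (5 * sa) by field; rewrite !gt_eqF.
  exact: (newton_drift n_gt0 lambda_gt0 mu_gt0 L_gt0 alpha_ge1 f_avg f_C2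
    diff_psi smooth_psi sc_f lip_f f_min near_y symP P_lower P_upper near_x).
have B2le : p%:R ^+ 2 * (12 * (alpha * kappa * beta / n%:R) ^+ 2
    * (dist2 x + dist2 y)) <= (dist2 x + theta * dist2 y) / 4.
  apply: (@le_trans _ _ (theta * (dist2 x + dist2 y) / 4)); last first.
    by rewrite ler_wpM2r // invr_ge0.
  have := ler_wpM2r (addr_ge0 D0 E0) theta_max.
  move: (dist2 x + dist2 y) => S; lra.
have s2le : 4 * 641 * p%:R ^+ 2 * (4 * K * (dist2 x + dist2 y))
    <= g * (dist2 x + theta * dist2 y).
  apply: le_trans (ler_wpM2l g0 Phi).
  rewrite le_eqVlt; apply/orP; left; apply/eqP.
  rewrite /g /K; move: (dist2 x + _) => S.
  by field; rewrite !gt_eqF.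
have gble : g * b%:R <= p%:R * a / 8.
  pose U := p%:R * (b%:R * beta / n%:R) / (40 * theta).
  have U0 : 0 <= U by rewrite divr_ge0 ?mulr_ge0 ?ler0n // ltW.
  have -> : p%:R * a / 8 = U * theta by rewrite /U; field; rewrite !gt_eqF.
  apply: le_trans (ler_wpM2l U0 theta_var).
  (* Source of the constant in [theta_var]: [40 * 16 * 641 = 410240 <= 5 * 10 ^+ 5]. *)
  have -> : g * b%:R = U * (40 * 16 * 641 * p%:R * (alpha ^+ 2 * kappa * beta / n%:R)).
    by rewrite /g /U /K; field; rewrite !gt_eqF.
  apply: ler_wpM2l => //; rewrite -(mulrA _ p%:R) -(mulrA (5 * _) p%:R).
  apply: ler_wpM2r; last lra.
  apply: mulr_ge0; first by rewrite ler0n.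
  apply: divr_ge0; last exact: ltW.
  exact: (mulr_ge0 (mulr_ge0 (sqr_ge0 _) (ltW kappa_gt0)) beta_ge0).
rewrite (@eq_avg _ _ _ (fun B : b.-tuple 'I_n =>
  (Q (foldl (fun m i => m + draw_shift x i)
    (x - xstar - eta *: (invmx P *m grad f x)) B) + theta * dist2 y) ^+ p)); last first.
  by move=> B; rewrite -inner_step_foldl.
exact: (moment_batch hsym hge0 (card_ord_gt0 n_gt0) w0 D0 (draw_shift_sum x)
  (draw_shift_bound x) (draw_shift_var near_x) a0 a1 g0 B2le s2le gble hm).
Qed.

End InnerLoop.
End SvrnStep.

(** * Outer iterations *)

Section Epochs.
Variables (R : realType) (d n b m : nat).
Variables (psi : 'I_n -> 'cV[R]_d -> R) (f : 'cV[R]_d -> R) (eta : R).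
Variable oracle : seq (epoch n b m) -> 'cV[R]_d -> 'M[R]_d.
Variables (D : 'cV[R]_d -> R) (N : pred 'cV[R]_d) (Z theta r : R) (p : nat).
Hypothesis n_gt0 : (0 < n)%N.
Hypotheses (D_ge0 : forall x, 0 <= D x) (Z_gt0 : 0 < Z).
Hypothesis D_exit : forall x, ~~ N x -> Z <= D x.
Hypotheses (theta_gt0 : 0 < theta) (theta_le : theta <= 1 / 48).
Hypotheses (r_ge0 : 0 <= r) (r_le1 : r <= 1) (rm_le : r ^+ m <= theta).
Hypotheses (p_gt0 : (0 < p)%N) (m_lt : m.+1%:R <= (3 : R) ^+ p).
Hypothesis drift : forall hist y x, N y -> N x ->
  avg (fun B : b.-tuple 'I_n =>
    (D (inner_step psi f eta (oracle hist y) y x B) + theta * D y) ^+ p)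
  <= r ^+ p * (D x + theta * D y) ^+ p + (8 * (theta * D y)) ^+ p.

Let batch_gt0 : (0 < #|{: b.-tuple 'I_n}|)%N.
Proof. by rewrite card_tuple card_ord expn_gt0 n_gt0. Qed.

Lemma card_epoch_gt0 : (0 < #|epoch n b m|)%N.
Proof. by rewrite /epoch card_tuple expn_gt0 batch_gt0. Qed.

Definition epoch_stays hist (y : 'cV[R]_d) (e : epoch n b m) : bool :=
  stays (inner_step psi f eta (oracle hist y) y) N y e.

Lemma epoch_stays_end hist y e : epoch_stays hist y e ->
  N (outer_step psi f eta (oracle hist y) y e).
Proof.
suff key (step : 'cV[R]_d -> b.-tuple 'I_n -> 'cV[R]_d) s z :
  stays step N z s -> N (foldl step z s) by exact: key.
elim: s z => [|B s IH] z /=; first by rewrite andbT.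
by case/andP=> _; exact: IH.
Qed.

Let Psi y x := (D x + theta * D y) ^+ p.
Let F y := (8 * (theta * D y)) ^+ p.

Let thetaD_ge0 y : 0 <= theta * D y.
Proof. by rewrite mulr_ge0 // ltW. Qed.

Let F_ge0 y : 0 <= F y.
Proof. by rewrite exprn_ge0 // mulr_ge0. Qed.

Let Psi_ge0 y x : 0 <= Psi y x.
Proof. by rewrite exprn_ge0 // addr_ge0. Qed.

Let rp_ge0 : 0 <= r ^+ p. Proof. exact: exprn_ge0. Qed.
Let rp_le1 : r ^+ p <= 1. Proof. exact: exprn_ile1. Qed.

(* The number [m] of steps of an epoch is absorbed by [3 ^+ p]. *)
Let absorb (A c : R) : 0 <= A -> A <= c -> A ^+ p + m%:R * c ^+ p <= (3 * c) ^+ p.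
Proof.
move=> A0 Ac; have c0 := le_trans A0 Ac.
rewrite exprMn; apply: (@le_trans _ _ (m.+1%:R * c ^+ p)).
  rewrite -natr1 mulrDl mul1r addrC lerD2l.
  by apply: lerXn2r; rewrite ?nnegrE.
by apply: ler_wpM2r => //; exact: exprn_ge0.
Qed.

(** The initial potential decays to at most [2 * theta * D y], below the per-step term
    [8 * theta * D y]; absorbing the [m] steps triples the latter, whence 24. *)
Lemma epoch_moment hist y : N y ->
  avg (fun e : epoch n b m => (epoch_stays hist y e)%:R *
    D (outer_step psi f eta (oracle hist y) y e) ^+ p) <= (24 * theta * D y) ^+ p.
Proof.
move=> Ny.
have := @avg_killed_le _ _ _ (inner_step psi f eta (oracle hist y) y) N (Psi y)
  _ _ batch_gt0 rp_ge0 rp_le1 (F_ge0 y) (Psi_ge0 y)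
  (fun x => @drift hist y x Ny) m y.
have le1 : avg (fun e : epoch n b m => (epoch_stays hist y e)%:R *
    D (outer_step psi f eta (oracle hist y) y e) ^+ p) <=
  avg (fun w : m.-tuple (b.-tuple 'I_n) =>
    (stays (inner_step psi f eta (oracle hist y) y) N y w)%:R *
    Psi y (foldl (inner_step psi f eta (oracle hist y) y) y w)).
  apply: ler_avg => e; apply: ler_wpM2l; first exact: ler0n.
  by apply: lerXn2r; rewrite ?nnegrE ?addr_ge0 // lerDl.
move/(le_trans le1)/le_trans; apply.
have -> : r ^+ p ^+ m * Psi y y = (r ^+ m * (D y + theta * D y)) ^+ p.
  by rewrite exprMn -!exprM mulnC.
have -> : 24 * theta * D y = 3 * (8 * (theta * D y)) by ring.
apply: absorb; first by rewrite mulr_ge0 ?addr_ge0 ?exprn_ge0.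
have h1 : r ^+ m * (D y + theta * D y) <= theta * (2 * D y).
  apply: ler_pM; rewrite ?exprn_ge0 ?addr_ge0 //.
  have : theta * D y <= 1 * D y.
    by apply: ler_wpM2r => //; move: theta_le; lra.
  lra.
by apply: (le_trans h1); have := thetaD_ge0 y; lra.
Qed.

(** Both the initial potential and the per-step term are at most [2 * D y] as [theta <= 1 / 48];
    absorbing the [m] steps triples this, whence 6. *)
Lemma epoch_exit hist y : N y ->
  avg (fun e : epoch n b m => (~~ epoch_stays hist y e)%:R) <= (6 * D y / Z) ^+ p.
Proof.
move=> Ny.
have Zp : 0 < Z ^+ p by exact: exprn_gt0.
have hZ x : ~~ N x -> Z ^+ p <= Psi y x.
  move=> /D_exit h; apply: lerXn2r; rewrite ?nnegrE ?addr_ge0 ?(ltW Z_gt0) //.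
  by apply: (le_trans h); rewrite lerDl.
have := @exit_prob_le _ _ _ (inner_step psi f eta (oracle hist y) y) N (Psi y)
  _ _ batch_gt0 rp_le1 (F_ge0 y) (Psi_ge0 y)
  (fun x => @drift hist y x Ny) _ m y (ltW Zp) hZ.
rewrite [leLHS]mulrC expr_div_n ler_pdivlMr // => /le_trans; apply.
have h : theta * D y <= 1 / 48 * D y by exact: ler_wpM2r.
have -> : 6 * D y = 3 * (2 * D y) by ring.
have Dy := D_ge0 y.
have h2 : D y + theta * D y <= 2 * D y by move: h; lra.
have h3 : 8 * (theta * D y) <= 2 * D y by move: h; lra.
apply: le_trans (absorb (addr_ge0 Dy (thetaD_ge0 y)) h2).
rewrite lerD2l; apply: ler_wpM2l; first exact: ler0n.
by apply: lerXn2r; rewrite ?nnegrE ?mulr_ge0 // ltW.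
Qed.

(** Induction on the number of epochs, conditioning on the first. Either that epoch leaves the
    region, or the inductive bound applies at its endpoint and is averaged with [epoch_moment]. The
    first summand controls all exits, the second is Markov's inequality at the end. *)
Lemma svrn_fail_prob (tau : R) k hist x : 0 < tau -> N x ->
  avg (fun w : k.-tuple (epoch n b m) =>
    (~~ (N (mb_svrn_from psi f eta oracle hist x w)
         && (D (mb_svrn_from psi f eta oracle hist x w) <= tau)))%:R)
  <= 2 * (6 * D x / Z) ^+ p + ((24 * theta) ^+ k * D x / tau) ^+ p.
Proof.
move=> tau0; elim: k hist x => [|k IH] hist x Nx.
  rewrite avg_tuple0 /= Nx expr0 mul1r.
  have h0 : 0 <= 2 * (6 * D x / Z) ^+ p.
    by rewrite mulr_ge0 // exprn_ge0 // divr_ge0 ?mulr_ge0 // ltW.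
  have [Dt|tD] /= := leP (D x) tau.
    by rewrite addr_ge0 // exprn_ge0 // divr_ge0 // ltW.
  apply: (@le_trans _ _ ((D x / tau) ^+ p)); last by rewrite lerDr.
  by rewrite exprn_ege1 // ler_pdivlMr // mul1r ltW.
rewrite (@avg_tupleS R (epoch n b m)).
pose y (e : epoch n b m) := outer_step psi f eta (oracle hist x) x e.
(* The inductive bound is homogeneous of degree [p] in [D]; [A] is its coefficient. *)
pose A := 2 * (6 / Z) ^+ p + ((24 * theta) ^+ k / tau) ^+ p.
have AE v : A * v ^+ p = 2 * (6 / Z * v) ^+ p + ((24 * theta) ^+ k / tau * v) ^+ p.
  by rewrite !(exprMn _ _ v) /A; ring.
have A0 : 0 <= A.
  rewrite addr_ge0 ?mulr_ge0 ?exprn_ge0 ?divr_ge0 ?(ltW Z_gt0) ?(ltW tau0) //.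
  by rewrite exprn_ge0 // mulr_ge0 // ltW.
pose W : R := (avg (fun e : epoch n b m =>
   (~~ epoch_stays hist x e)%:R + A * ((epoch_stays hist x e)%:R * D (y e) ^+ p))).
apply: (@le_trans _ _ W).
  apply: ler_avg => e; have [se|se] := boolP (epoch_stays hist x e); last first.
    rewrite mul0r mulr0 addr0 /=.
    rewrite -[leRHS](@avg_cst R (k.-tuple (epoch n b m))); last first.
      by rewrite card_tuple expn_gt0 card_epoch_gt0.
    by apply: ler_avg => w; rewrite ler_nat leq_b1.
  rewrite /= add0r mul1r; have := IH (rcons hist e) _ (epoch_stays_end se).
  rewrite -/(y e) => /le_trans; apply.
  rewrite AE.
  have -> : 6 * D (y e) / Z = 6 / Z * D (y e) by ring.
  by have -> : (24 * theta) ^+ k * D (y e) / tau = (24 * theta) ^+ k / tau * D (y e) by ring.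
rewrite /W avgD avgZ.
have h1 := epoch_exit hist Nx; have h2 := ler_wpM2l A0 (epoch_moment hist Nx).
apply: (le_trans (lerD h1 h2)).
have t1 : 24 * theta <= 1 / 2 by move: theta_le; lra.
have t0 : 0 <= 24 * theta by rewrite mulr_ge0 // ltW.
(* The factor 2 in front of the exit term closes the induction: one for the current epoch plus half
   of 2 for the later ones. *)
have tp : (24 * theta) ^+ p <= 1 / 2.
  apply: le_trans t1; apply: ler_iXnr => //; move: theta_le; lra.
have -> : A * (24 * theta * D x) ^+ p =
  2 * ((24 * theta) ^+ p * (6 * D x / Z) ^+ p)
  + ((24 * theta) ^+ k.+1 * D x / tau) ^+ p.
  by rewrite AE -exprMn exprSr; congr (2 * _ ^+ p + _ ^+ p); ring.
rewrite addrA lerD2r.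
have Q0 : 0 <= (6 * D x / Z) ^+ p.
  by rewrite exprn_ge0 // divr_ge0 ?mulr_ge0 // ltW.
have := ler_wpM2r Q0 tp.
by move: ((6 * D x / Z) ^+ p) ((24 * theta) ^+ p) => u v; lra.
Qed.

End Epochs.

(** * Choice of the constants *)

Section Scalars.
Variable R : realType.
Implicit Types x t : R.

Lemma ln_le_exprn x t (k : nat) : 0 < t -> x = t ^+ k -> ln x <= k%:R * t.
Proof.
move=> t0 ->; rewrite lnXn // -[ln t *+ k]mulr_natl; apply: ler_wpM2l; first exact: ler0n.
exact/ltW/ln_sublinear.
Qed.

Lemma ln_ge1 x : 3 <= x -> 1 <= ln x.
Proof.
move=> x3; rewrite -(expRK 1) ler_ln ?posrE ?expR_gt0 //; last exact: lt_le_trans x3.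
exact: le_trans (expR1_le3 R) x3.
Qed.

Lemma ln_ler x y : 0 < x -> x <= y -> ln x <= ln y.
Proof. by move=> x0 xy; rewrite ler_ln // posrE // (lt_le_trans x0). Qed.

(** Its square root [10 ^+ 11] exceeds the product [48 * 5 * 10 ^+ 5 * 96 * 20] that arises in
    [scalar_params]. *)
Definition sample_const : R := 10 ^+ 22.
(** The least value allowed by [theta_var], with [beta] written out. *)
Definition theta_of (n : nat) (kappa alpha : R) (p : nat) : R :=
  5 * 10 ^+ 5 * p%:R
  * (alpha ^+ 2 * kappa * (32 * ln (n%:R / (2 * alpha ^+ 2 * kappa))) / n%:R).

(** Everything is measured by [N = n / (kappa alpha^2)] and its fourth root [t]. All logarithms are
    at most constant multiples of [t], so [p * beta] is of order at most [t ^+ 2], whereas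
    [N = t ^+ 4] and [t ^+ 2] is at least [10 ^+ 11]. *)
Lemma scalar_params (kappa alpha delta : R) (n : nat) :
  1 <= kappa -> 1 <= alpha -> 0 < delta -> delta <= 1 -> (0 < n)%N ->
  sample_const * kappa * alpha ^+ 2 * ln (2 * sample_const * kappa * alpha ^+ 2 / delta) ^+ 7 < n%:R ->
  let beta : R := 32 * ln (n%:R / (2 * alpha ^+ 2 * kappa)) in
  exists q : nat, let theta := theta_of n kappa alpha q.+2 in
    [/\ 32 <= beta, beta <= 32 * ln (n%:R / kappa) & 0 < theta <= 1 / 48] /\
    [/\ ln (n%:R / delta) + 1 <= q.+2%:R, expR (- (beta / 10)) <= theta &
        24 * theta <= 24 * 5 * 10 ^+ 5 * 96 * kappa * alpha ^+ 2
          * ln (n%:R / delta) ^+ 2 / n%:R].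
Proof.
move=> k1 a1 d0 d1 n0 hn beta.
have n0R : 0 < n%:R :> R by rewrite ltr0n.
pose K := kappa * alpha ^+ 2.
have asq : 1 <= alpha ^+ 2 by rewrite exprn_ege1.
have K1 : 1 <= K by rewrite /K -(mulr1 1); apply: ler_pM.
have K0 : 0 < K by exact: lt_le_trans K1.
have kappa0 : 0 < kappa by exact: lt_le_trans k1.
have alpha0 : 0 < alpha by exact: lt_le_trans a1.
pose N := n%:R / K.
have nE : n%:R = N * K by rewrite /N mulfVK // gt_eqF.
have N0 : 0 < N by rewrite divr_gt0.
have c1E : sample_const = (10 ^+ 11) ^+ 2 :> R by rewrite /sample_const -exprM.
have c10 : 0 < sample_const :> R by rewrite exprn_gt0.
have c1_3 : 3 <= 2 * sample_const :> R.
  have : 1 <= sample_const / 10 :> R by rewrite /sample_const exprSr mulfK ?exprn_ege1 //; lra.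
  lra.
have dV : 1 <= delta^-1 by rewrite invf_ge1.
pose l := ln (2 * sample_const * kappa * alpha ^+ 2 / delta).
have argE : 2 * sample_const * kappa * alpha ^+ 2 / delta = 2 * sample_const * (K / delta).
  by rewrite /K; ring.
have Kd : 1 <= K / delta by rewrite -(mulr1 1); apply: ler_pM.
have l1 : 1 <= l.
  apply: ln_ge1; rewrite argE -(mulr1 3); apply: ler_pM => //.
have Kdl : ln (K / delta) <= l.
  apply: ln_ler; first exact: lt_le_trans Kd.
  rewrite argE; apply: ler_peMl; first exact: le_trans Kd.
  by apply: le_trans c1_3; lra.
have hN : sample_const * l ^+ 7 < N.
  rewrite ltr_pdivlMr //; apply: le_lt_trans hn.
  by rewrite -/l /K le_eqVlt; apply/orP; left; apply/eqP; ring.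
have l7 : 1 <= l ^+ 7 by rewrite exprn_ege1.
have cN : sample_const <= N.
  by apply: le_trans (ltW hN); rewrite ler_peMr // ltW.
have lN : l ^+ 4 <= N.
  apply: le_trans (ltW hN).
  apply: (@le_trans _ _ (1 * l ^+ 7)).
    by rewrite mul1r; apply: ler_weXn2l.
  apply: ler_wpM2r; first exact: le_trans ler01 l7.
  by rewrite /sample_const exprn_ege1 //; lra.
pose t := Num.sqrt (Num.sqrt N).
have tN : N = t ^+ 4.
  by rewrite (exprM t 2 2) /t !sqr_sqrtr // ?sqrtr_ge0 // ltW.
have t0 : 0 < t by rewrite /t !sqrtr_gt0.
have t2 : 10 ^+ 11 <= t ^+ 2.
  rewrite -(@ler_pXn2r _ 2) ?nnegrE ?sqr_ge0 ?exprn_ge0 // -c1E -exprM -tN //.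
have lt : l <= t.
  rewrite -(@ler_pXn2r _ 4) ?nnegrE ?(ltW t0) -?tN //.
  exact: le_trans l1.
have lnN : ln N <= 4 * t by exact: ln_le_exprn tN.
have N6 : 6 <= N.
  apply: le_trans cN; have : 1 <= sample_const / 10 :> R.
    by rewrite /sample_const exprSr mulfK ?exprn_ege1 //; lra.
  lra.
have bE : beta = 32 * ln (N / 2).
  rewrite /beta; congr (32 * ln _); rewrite /N /K; field.
  by rewrite !gt_eqF.
have lN2 : 1 <= ln (N / 2) by apply: ln_ge1; rewrite ler_pdivlMr //; lra.
have b32 : 32 <= beta by rewrite bE ler_peMr.
have lN2N : ln (N / 2) <= ln N.
  by apply: ln_ler; [rewrite divr_gt0|rewrite ler_pdivrMr //; lra].
have lnN1 : 1 <= ln N by exact: le_trans lN2N.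
have nkE : ln N <= ln (n%:R / kappa).
  apply: ln_ler => //; rewrite /N /K invfM mulrA ler_pdivrMr ?exprn_gt0 //.
  by rewrite ler_peMr // divr_ge0 // ltW.
pose l2 := ln (n%:R / delta).
have l2E : l2 = ln N + ln (K / delta).
  by rewrite /l2 nE -mulrA [LHS]lnM // posrE divr_gt0.
have lKd0 : 0 <= ln (K / delta) by exact: ln_ge0.
have l2N : ln N <= l2 by rewrite l2E lerDl.
have l21 : 1 <= l2 by exact: le_trans l2N.
have l2t : l2 <= 5 * t by rewrite l2E; move: lnN Kdl lt; lra.
(* The exponent will be [p = m + 1]: it exceeds [l2 + 1], and [l2 >= 1] gives
   [p <= l2 + 2 <= 3 * l2]. Since [m] is positive, [p] has the form [q.+2]. *)
pose m := Num.truncn (l2 + 1).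
have m1 : l2 + 1 < m.+1%:R by exact: truncnS_gt.
have m2 : m%:R <= l2 + 1 by rewrite truncn_le // addr_ge0 // (le_trans ler01).
have : (0 < m)%N.
  rewrite -ltnS -(ltr_nat R); apply: lt_trans m1; move: l21; lra.
case: m m1 m2 => // q m1 m2 _.
have p3 : q.+2%:R <= 3 * l2.
  by rewrite -natr1; move: m2 l21; lra.
exists q.
have p0 : 0 < q.+2%:R :> R by rewrite ltr0n.
have thE : theta_of n kappa alpha q.+2 = 5 * 10 ^+ 5 * (q.+2%:R * beta) / N.
  rewrite /theta_of -/beta nE /K; field.
  by rewrite !gt_eqF.
have beta0 : 0 < beta by exact: lt_le_trans b32.
have pb : q.+2%:R * beta <= 96 * (l2 * ln N).
  have -> : 96 * (l2 * ln N) = 3 * l2 * (32 * ln N) by ring.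
  apply: ler_pM; rewrite ?ler0n ?(ltW beta0) //.
  by rewrite bE ler_pM2l.
have th0 : 0 < theta_of n kappa alpha q.+2.
  by rewrite thE; apply: divr_gt0 => //; apply: mulr_gt0; [lra|exact: mulr_gt0].
split; split.
- exact: b32.
- by rewrite bE ler_pM2l // (le_trans lN2N).
- rewrite th0 /= thE ler_pdivrMr //.
  have h1 : l2 * ln N <= 5 * t * (4 * t).
    by apply: ler_pM => //; [exact: le_trans l21|exact: le_trans lnN1].
  have h2 : 10 ^+ 11 * t ^+ 2 <= N.
    rewrite tN (exprD t 2 2); apply: ler_wpM2r => //; exact: sqr_ge0.
  move: pb h1 h2; move: (q.+2%:R * beta) (l2 * ln N) => u v.
  rewrite (_ : 5 * t * (4 * t) = 20 * t ^+ 2); last by ring.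
  by have := sqr_ge0 t; move: (t ^+ 2) => w; lra.
- by move: m1; rewrite -/l2; lra.
(* [beta / 10] is [16 / 5] times [ln (N / 2)]; one such logarithm already yields [2 / N], which is
   below [theta]. *)
- have -> : - (beta / 10) = - ln (N / 2) - 11 / 5 * ln (N / 2).
    by rewrite bE; field.
  apply: (@le_trans _ _ (expR (- ln (N / 2)))).
    rewrite ler_expR; move: lN2; lra.
  rewrite expRN lnK ?posrE ?divr_gt0 // invf_div thE.
  apply: ler_wpM2r; first by rewrite invr_ge0 ltW.
  have h : 1 <= q.+2%:R * beta.
    apply: mulr_ege1; first by rewrite ler1n.
    by apply: le_trans b32; lra.
  have c : 2 <= 5 * 10 ^+ 5 :> R by lra.
  by apply: (le_trans c); apply: ler_peMr => //; lra.
have -> : 24 * theta_of n kappa alpha q.+2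
  = 24 * 5 * 10 ^+ 5 / N * (q.+2%:R * beta) by rewrite thE; ring.
have -> : 24 * 5 * 10 ^+ 5 * 96 * kappa * alpha ^+ 2 * ln (n%:R / delta) ^+ 2 / n%:R
  = 24 * 5 * 10 ^+ 5 / N * (96 * (l2 * l2)).
  by rewrite /N /K /l2; field; rewrite !gt_eqF.
have c : 0 <= 24 * 5 * 10 ^+ 5 / N.
  by apply: divr_ge0; [lra|exact: ltW].
apply: ler_wpM2l => //; apply: (le_trans pb).
by rewrite ler_pM2l // ler_pM2l // (lt_le_trans ltr01).
Qed.

End Scalars.

(** * Probability bound *)

Section Assembly.
Variable R : realType.

Lemma counting_prob_ge (Omega : finType) (bad P : pred Omega) (epsilon : R) :
  (0 < #|Omega|)%N -> (forall w, ~~ bad w -> P w) ->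
  avg (fun w => (bad w)%:R) <= epsilon ->
  1 - epsilon <= counting_prob R [set w | P w]%SET.
Proof.
move=> O0 goodP bade.
have -> : counting_prob R [set w | P w]%SET = avg (fun w => (P w)%:R).
  rewrite /counting_prob /avg mulrC cardsE -sum1_card natr_sum big_mkcond /=.
  by congr (_ * _); apply: eq_bigr => w _; rewrite unfold_in; case: (P w).
rewrite lerBlDr; apply: le_trans (lerD (lexx _) bade).
apply: (@le_trans _ _ (avg (fun _ : Omega => 1))); first by rewrite avg_cst.
rewrite -avgD; apply: ler_avg => w; have [bw|/goodP ->] := boolP (bad w).
  by rewrite -natrD ler1n addn1.
by rewrite lerDl.
Qed.

Lemma counting_prob_sure (Omega : finType) (P : pred Omega) (delta : R) :
  (0 < #|Omega|)%N -> (forall w, P w) -> 0 <= delta ->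
  1 - 2 * delta <= counting_prob R [set w | P w]%SET.
Proof.
move=> O0 allP d0; apply: (counting_prob_ge (bad := xpred0)) => //.
by apply: (@le_trans _ _ 0); [rewrite avg_cst|rewrite mulr_ge0].
Qed.

(** At the anchor the sampled gradients cancel, so an epoch started at a critical point never moves.
    This settles a start at the minimiser, where [dist2] is 0. *)
Lemma mb_svrn_fixed (d n b m : nat) (psi : 'I_n -> 'cV[R]_d -> R)
    (f : 'cV[R]_d -> R) (eta : R)
    (oracle : seq (epoch n b m) -> 'cV[R]_d -> 'M[R]_d) x hist
    (w : seq (epoch n b m)) :
  grad f x = 0 -> mb_svrn_from psi f eta oracle hist x w = x.
Proof.
move=> gx; have inner P B : inner_step psi f eta P x x B = x :> 'cV[R]_d.
  by rewrite /inner_step /svrg_gradient subrr gx addr0 mulmx0 scaler0 subr0.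
have outer P (e : epoch n b m) : outer_step psi f eta P x e = x.
  by rewrite /outer_step; elim: (val e : seq _) => //= B s IH; rewrite inner.
by elim: w hist => //= e w IH hist; rewrite outer.
Qed.

Lemma sub_colmx_dim0 (x y : 'cV[R]_0) : x = y.
Proof. by rewrite (flatmx0 x) (flatmx0 y). Qed.

(** Both inequalities are tested on a unit vector, which exists in positive dimension; this gives
    [kappa >= 1]. *)
Lemma strong_convexity_le_smoothness (d : nat) (f : 'cV[R]_d.+1 -> R) (lambda mu : R) :
  smooth lambda f -> strongly_convex mu f -> mu <= lambda.
Proof.
move=> sf cf; pose v : 'cV[R]_d.+1 := delta_mx ord0 0.
have := sf 0 v; have := cf 0 v; rewrite subr0 enorm_sqr.
have -> : dotv v v = 1.
  rewrite /dotv (bigD1 ord0) //= big1 => [|i /negbTE i0]; last first.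
    by rewrite !mxE i0 mul0r.
  by rewrite !mxE !eqxx mulr1 addr0.
lra.
Qed.

Lemma expn3_ge (x : R) (p : nat) : x <= p%:R -> expR x <= 3 ^+ p.
Proof.
move=> xp; apply: (@le_trans _ _ (expR p%:R)); first by rewrite ler_expR.
rewrite -[p%:R]mulr1 expRM_natl; apply: lerXn2r; rewrite ?nnegrE ?expR_ge0 //.
exact: expR1_le3.
Qed.

End Assembly.

(** * From moment bounds to a high-probability bound on function values *)

Section HighProbability.
Variables (R : realType) (d : nat) (f : 'cV[R]_d -> R).
Variables (n : nat) (psi : 'I_n -> 'cV[R]_d -> R).
Variables (lambda mu L alpha : R) (xstar : 'cV[R]_d).
Hypotheses (n_gt0 : (0 < n)%N) (lambda_gt0 : 0 < lambda).
Hypotheses (mu_gt0 : 0 < mu) (L_gt0 : 0 < L) (alpha_ge1 : 1 <= alpha).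
Hypothesis f_avg : forall x, f x = n%:R^-1 * \sum_(i < n) psi i x.
Hypothesis f_C2 : twice_continuously_differentiable f.
Hypothesis diff_psi : forall i x, differentiable (psi i) x.
Hypothesis convex_psi : forall i, convex_function setT (psi i).
Hypothesis smooth_psi : forall i, smooth lambda (psi i).
Hypothesis sc_f : strongly_convex mu f.
Hypothesis lip_f : hessian_lipschitz L f.
Hypothesis f_min : forall x, f xstar <= f x.

Local Notation sa := (Num.sqrt alpha).
Local Notation dist2 := (dist2 f xstar).
Local Notation in_region := (in_region f mu L alpha xstar).
Local Notation kappa := (lambda / mu).
Local Notation Z := (mu ^+ 3 / (L ^+ 2 * (8 * alpha) ^+ 2)).

Variables (q b : nat) (beta theta delta rho : R).
Local Notation p := q.+2.
Local Notation eta := (b%:R * sa * beta / n%:R).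
Local Notation tmax := (n %/ b)%N.
Hypotheses (b_gt0 : (0 < b)%N) (b_dvd : (b %| n)%N) (beta_gt0 : 0 < beta).
Hypotheses (theta_gt0 : 0 < theta) (theta_le : theta <= 1 / 48).
Hypothesis eta_le : eta * sa <= 7 / 8.
Hypothesis thetaE : theta =
  5 * 10 ^+ 5 * p%:R * (alpha ^+ 2 * kappa * beta / n%:R).
Hypothesis exp_le : expR (- (beta / 10)) <= theta.
Hypotheses (delta_gt0 : 0 < delta) (delta_le1 : delta <= 1).
Hypothesis p_ge : ln (n%:R / delta) + 1 <= p%:R.
Hypothesis rho_ge : 8 * (24 * theta) <= rho.

Variable oracle : seq (epoch n b tmax) -> 'cV[R]_d -> 'M[R]_d.
Hypothesis oracleP : hessian_oracle alpha f oracle.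

Let alpha_gt0 : 0 < alpha. Proof. exact: lt_le_trans alpha_ge1. Qed.
Let nR_gt0 : 0 < n%:R :> R. Proof. by rewrite ltr0n. Qed.
Let bR_gt0 : 0 < b%:R :> R. Proof. by rewrite ltr0n. Qed.
Let kappa_gt0 : 0 < kappa. Proof. by rewrite divr_gt0. Qed.

Let Lalpha_gt0 : 0 < L ^+ 2 * (8 * alpha) ^+ 2.
Proof. by rewrite mulr_gt0 ?exprn_gt0 // mulr_gt0. Qed.

Let d2_ge0 x : 0 <= dist2 x.
Proof. exact: (dist2_ge0 xstar mu_gt0 L_gt0 f_C2 sc_f lip_f). Qed.

Lemma in_regionE x : in_region x = (dist2 x <= Z).
Proof. by rewrite /in_region ler_pdivlMr // mulrC. Qed.

(** The jump condition follows from the variance condition: its left-hand side is [48 * u * u] with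
    [u <= theta <= 1 / 48]. *)
Let theta_max : 48 * p%:R ^+ 2 * (alpha * kappa * beta / n%:R) ^+ 2 <= theta.
Proof.
pose u := theta / (5 * 10 ^+ 5 * alpha).
have c : 0 < 5 * 10 ^+ 5 :> R by lra.
have -> : 48 * p%:R ^+ 2 * (alpha * kappa * beta / n%:R) ^+ 2 = 48 * u * u.
  rewrite /u thetaE; field.
  by rewrite !gt_eqF.
have u0 : 0 < u by rewrite divr_gt0 // mulr_gt0.
have u1 : u <= theta.
  rewrite ler_pdivrMr ?mulr_gt0 // ler_peMr ?(ltW theta_gt0) //.
  by apply: mulr_ege1 => //; lra.
have u48 : 48 * u <= 1 by move: u1 theta_le; lra.
by apply: le_trans u1; rewrite ler_piMl // ltW.
Qed.

Let exp_p_ge : n%:R / delta <= expR (p%:R - 1).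
Proof.
rewrite -[leLHS]lnK ?posrE ?divr_gt0 // ler_expR; move: p_ge; lra.
Qed.

(** The spare unit in [p_ge] supplies the factor [e >= 2]; the bound is what [absorb] requires of
    the number of inner steps. *)
Let n_le : 2 * n%:R <= 3 ^+ p :> R.
Proof.
apply: le_trans (expn3_ge (lexx _)).
have -> : expR p%:R = expR 1 * expR (p%:R - 1) :> R by rewrite -expRD addrC subrK.
have e2 : 2 <= expR 1 :> R by have := expR_ge1Dx (1 : R); lra.
apply: ler_pM => //.
by apply: le_trans exp_p_ge; rewrite ler_peMr ?invf_ge1 // ltW.
Qed.

Let third_p_le : (1 / 3) ^+ p <= delta.
Proof.
rewrite expr_div_n expr1n div1r.
have h : n%:R / delta <= 3 ^+ p.
  apply: (le_trans exp_p_ge); apply: expn3_ge; lra.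
rewrite invf_ple ?posrE ?exprn_gt0 //; apply: le_trans h.
by rewrite ler_peMl ?invr_ge0 ?(ltW delta_gt0) // ler1n.
Qed.

Lemma svrn_high_prob (x0 : 'cV[R]_d) (s : nat) : (0 < s)%N ->
  0 < dist2 x0 -> 6 * dist2 x0 <= 1 / 6 * Z ->
  1 - 2 * delta <=
    counting_prob R [set w : s.-tuple (epoch n b tmax) |
      f (mb_svrn psi f eta oracle x0 w) - f xstar
        <= rho ^+ s * (f x0 - f xstar)]%SET.
Proof.
move=> s0 D0 DZ.
have Z0 : 0 < Z by rewrite divr_gt0 ?exprn_gt0.
have Nx0 : in_region x0 by rewrite in_regionE; move: DZ D0 Z0; lra.
have rho0 : 0 < rho by apply: lt_le_trans rho_ge; rewrite !mulr_gt0.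
(* The factor 3/5 is the ratio of 3/8 and 5/8 in [near_fval], which converts distances into function
   values at both ends. *)
pose tau := 3 / 5 * rho ^+ s * dist2 x0.
have c0 : 0 <= 6 * dist2 x0 / Z.
  by apply: divr_ge0; [apply: mulr_ge0|exact: ltW].
have tau0 : 0 < tau by rewrite mulr_gt0 // mulr_gt0 // exprn_gt0.
pose r := expR (- (b%:R * beta / (5 * n%:R) / 2)).
(* As [b] divides [n], the [n / b] steps multiply to exactly [e^(- beta / 10)]. *)
have rm : r ^+ tmax <= theta.
  apply: le_trans exp_le; rewrite /r -expRM_natr ler_expR.
  have -> : n%:R = b%:R * tmax%:R :> R by rewrite -natrM mulnC divnK.
  rewrite le_eqVlt; apply/orP; left; apply/eqP; field.
  rewrite !gt_eqF // ltr0n divn_gt0 //; exact: dvdn_leq.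
have r0 : 0 <= r by exact: expR_ge0.
have r1 : r <= 1.
  rewrite expR_le1 oppr_le0 divr_ge0 // divr_ge0 ?mulr_ge0 // ltW //.
have mlt : tmax.+1%:R <= (3 : R) ^+ p.
  apply: le_trans n_le; have -> : 2 * n%:R = (2 * n)%:R :> R by rewrite natrM.
  by rewrite ler_nat mul2n -addnn -addn1 leq_add // leq_div.
have Dexit x : ~~ in_region x -> Z <= dist2 x.
  by rewrite in_regionE -ltNge => /ltW.
have theta1 : theta <= 1 by move: theta_le; lra.
have drift hist y x : in_region y -> in_region x ->
  avg (fun B : b.-tuple 'I_n =>
    (dist2 (inner_step psi f eta (oracle hist y) y x B) + theta * dist2 y) ^+ p)
  <= r ^+ p * (dist2 x + theta * dist2 y) ^+ p + (8 * (theta * dist2 y)) ^+ p.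
  move=> Ny Nx; have [symP lowP upP] := oracleP hist y.
  have tv : 5 * 10 ^+ 5 * p%:R * (alpha ^+ 2 * kappa * beta / n%:R) <= theta.
    by rewrite thetaE.
  exact: (inner_step_moment n_gt0 lambda_gt0 mu_gt0 L_gt0 alpha_ge1 f_avg f_C2
    diff_psi convex_psi smooth_psi sc_f lip_f f_min b_gt0 (ltW beta_gt0)
    theta_gt0 theta1 eta_le theta_max tv Ny symP lowP upP Nx).
have fail := svrn_fail_prob n_gt0 d2_ge0 Z0 Dexit theta_gt0 theta_le r0 r1 rm
  (ltn0Sn _) mlt drift s [::] tau0 Nx0.
apply: (counting_prob_ge _ (P := fun w : s.-tuple (epoch n b tmax) =>
  f (mb_svrn psi f eta oracle x0 w) - f xstar <= rho ^+ s * (f x0 - f xstar))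
  (bad := fun w : s.-tuple (epoch n b tmax) =>
   ~~ (in_region (mb_svrn_from psi f eta oracle [::] x0 w)
       && (dist2 (mb_svrn_from psi f eta oracle [::] x0 w) <= tau)))).
- by rewrite card_tuple expn_gt0 card_epoch_gt0.
- move=> w; rewrite negbK => /andP[Nw Dw].
  have [_ h1] := near_fval n_gt0 lambda_gt0 mu_gt0 L_gt0 alpha_ge1 f_avg f_C2
    diff_psi smooth_psi sc_f lip_f f_min Nw.
  have [h2 _] := near_fval n_gt0 lambda_gt0 mu_gt0 L_gt0 alpha_ge1 f_avg f_C2
    diff_psi smooth_psi sc_f lip_f f_min Nx0.
  have h3 := ler_wpM2l (exprn_ge0 s (ltW rho0)) h2.
  rewrite /mb_svrn; apply: (le_trans h1); apply: le_trans h3.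
  by move: Dw; rewrite /tau; lra.
apply: (le_trans fail).
have -> : 2 * delta = delta + delta by ring.
(* Exits and Markov's inequality cost [delta] each: in both cases the base of the [p]-th power is at
   most 1/3. *)
apply: lerD.
- apply: le_trans third_p_le.
  apply: (@le_trans _ _ ((2 * (6 * dist2 x0 / Z)) ^+ p)).
    rewrite [leRHS]exprMn; apply: ler_wpM2r.
      exact: exprn_ge0.
    by apply: ler_eXnr; rewrite ?ler1n.
  apply: lerXn2r; rewrite ?nnegrE //.
    exact: mulr_ge0.
  by rewrite mulrA ler_pdivrMr //; move: DZ; lra.
apply: le_trans third_p_le; apply: lerXn2r; rewrite ?nnegrE //.
  by rewrite divr_ge0 ?mulr_ge0 ?exprn_ge0 ?mulr_ge0 // ltW.
rewrite /tau.
have -> : (24 * theta) ^+ s * dist2 x0 / (3 / 5 * rho ^+ s * dist2 x0)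
   = 5 / 3 * (24 * theta / rho) ^+ s.
  rewrite expr_div_n; field; rewrite !gt_eqF // exprn_gt0 //.
have h8 : 24 * theta / rho <= 1 / 8 by rewrite ler_pdivrMr //; move: rho_ge; lra.
have h0 : 0 <= 24 * theta / rho by rewrite divr_ge0 ?mulr_ge0 // ltW.
(* Positivity of [s] enters here: a single factor 1/8 beats 5/3, as [5/24 <= 1/3]. *)
have : (24 * theta / rho) ^+ s <= 24 * theta / rho.
  by apply: ler_iXnr => //; move: h8; lra.
by move: h8; move: (_ / rho) (_ ^+ s) => u v; lra.
Qed.

End HighProbability.

(** * The step size and the starting point against the region *)

Section InitialPoint.
Variable R : realType.

Lemma step_size_le (alpha beta b n l : R) : 1 <= alpha -> 0 < n -> 0 < b ->
  0 < l -> b < n / (1000 * alpha * l) -> beta <= 32 * l ->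
  b * Num.sqrt alpha * beta / n * Num.sqrt alpha <= 4 / 125.
Proof.
move=> a1 n0 b0 l0 hb hbeta.
have a0 : 0 < alpha by exact: lt_le_trans a1.
have k0 : 0 < 1000 :> R by lra.
have -> : b * Num.sqrt alpha * beta / n * Num.sqrt alpha
  = b * Num.sqrt alpha ^+ 2 * beta / n by ring.
rewrite sqr_sqrt_alpha // ler_pdivrMr //.
have hb2 : b * (1000 * alpha * l) <= n.
  rewrite -ler_pdivlMr; first exact: ltW.
  exact: mulr_gt0 (mulr_gt0 k0 a0) l0.
have hb3 := ler_wpM2l (mulr_ge0 (ltW b0) (ltW a0)) hbeta.
by move: hb2 hb3; lra.
Qed.

(** As [e >= 2], the bound on [eps0] gives [eps0 * sqrt alpha <= 1/32]; times [4/125] this is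
    exactly [1/1000]. *)
Lemma initial_radius_le (alpha eps0 eta : R) : 1 <= alpha -> 0 <= eps0 ->
  eps0 <= 1 / (8 * expR 1 ^+ 2 * Num.sqrt alpha) -> 0 <= eta ->
  eta * Num.sqrt alpha <= 4 / 125 -> eps0 * eta * (1000 * alpha) <= 1.
Proof.
move=> a1 e0 e1 eta0 eta_small.
have sa0 : 0 < Num.sqrt alpha by exact: lt_le_trans (sqrt_alpha_ge1 a1).
have h1 : eps0 * (32 * Num.sqrt alpha) <= 1.
  rewrite -ler_pdivlMr ?mulr_gt0 //; apply: (le_trans e1).
  rewrite !div1r lef_pV2 ?posrE ?mulr_gt0 ?exprn_gt0 ?expR_gt0 //.
  apply: ler_wpM2r; first exact: ltW.
  have h2 : 2 <= expR 1 :> R by have := expR_ge1Dx (1 : R); lra.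
  by have : 0 <= (expR 1 - 2) * (expR 1 + 2) :> R; [apply: mulr_ge0; lra|lra].
rewrite -(sqr_sqrt_alpha a1).
have -> : eps0 * eta * (1000 * Num.sqrt alpha ^+ 2) =
  eps0 * (32 * Num.sqrt alpha) * (eta * Num.sqrt alpha) * (1000 / 32) by field.
have h0 : 0 <= eps0 * (32 * Num.sqrt alpha) by rewrite mulr_ge0 ?mulr_ge0 // ltW.
have h2 : 0 <= eta * Num.sqrt alpha by rewrite mulr_ge0 // ltW.
by have := ler_pM h0 h2 h1 eta_small; lra.
Qed.

(** Squaring the radius reduces the claim to [48 * alpha * eps <= 1], where 48 combines the 8 in the
    radius of the region with the square root of 36. *)
Lemma neighborhood_dist2_le (d : nat) (f : 'cV[R]_d -> R) (mu L alpha eps : R)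
    (xstar x : 'cV[R]_d) : 0 < mu -> 0 < L -> 1 <= alpha -> 0 <= eps ->
  eps * (1000 * alpha) <= 1 -> 0 <= dist2 f xstar x ->
  neighborhood f mu L xstar eps x ->
  6 * dist2 f xstar x <= 1 / 6 * (mu ^+ 3 / (L ^+ 2 * (8 * alpha) ^+ 2)).
Proof.
move=> mu0 L0 a1 eps0 heps D0; rewrite /neighborhood /= /mxnorm -/(dist2 f xstar x).
have a0 : 0 < alpha by exact: lt_le_trans a1.
have mu32 : (mu `^ (3 / 2)) ^+ 2 = mu ^+ 3.
  rewrite -powR_mulrn ?powR_ge0 // -powRrM.
  have -> : 3 / 2 * 2%:R = 3%:R :> R by field.
  by rewrite powR_mulrn // ltW.
have r0 : 0 <= mu `^ (3 / 2) / L * eps.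
  by rewrite mulr_ge0 // divr_ge0 ?powR_ge0 // ltW.
move=> /ltW; rewrite -(@ler_pXn2r _ 2) ?nnegrE ?sqrtr_ge0 // sqr_sqrtr //.
rewrite exprMn expr_div_n mu32 => hD.
have q0 : 0 < (48 * alpha) ^+ 2 by rewrite exprn_gt0 // mulr_gt0.
have -> : 1 / 6 * (mu ^+ 3 / (L ^+ 2 * (8 * alpha) ^+ 2)) =
    6 * (mu ^+ 3 / L ^+ 2 / (48 * alpha) ^+ 2).
  by field; rewrite !gt_eqF.
rewrite ler_pM2l // ler_pdivlMr //; apply: (le_trans (ler_wpM2r (ltW q0) hD)).
rewrite -mulrA -exprMn; apply: ler_piMr.
  by rewrite divr_ge0 ?exprn_ge0 // ltW.
have ea : 0 <= eps * alpha by rewrite mulr_ge0 // ltW.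
by rewrite exprn_ile1 //; move: heps ea; lra.
Qed.

End InitialPoint.

Theorem theorem5 (R : realType) :
  exists c1 c2 c3 : R,
    [/\ 0 < c1, 0 < c2 & 0 < c3] /\
    forall (d n : nat) (psi : 'I_n -> 'cV[R]_d -> R) (f : 'cV[R]_d -> R)
      (lambda mu L alpha : R) (xstar : 'cV[R]_d),
    (0 < n)%N ->
    0 < lambda -> 0 < mu -> 0 < L -> 1 <= alpha ->
    (forall x, f x = n%:R^-1 * \sum_(i < n) psi i x) ->
    twice_continuously_differentiable f ->
    (forall i x, differentiable (psi i) x) ->
    (forall i, convex_function setT (psi i)) ->
    (forall i, smooth lambda (psi i)) ->
    strongly_convex mu f ->
    hessian_lipschitz L f ->
    (forall x, f xstar <= f x) ->
    let kappa : R := lambda / mu in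
    forall (delta eps0 : R) (b : nat),
    0 < delta ->
    c1 * kappa * alpha ^+ 2 * ln (2 * c1 * kappa * alpha ^+ 2 / delta) ^+ 7
      < n%:R ->
    0 < eps0 -> eps0 < 1 / (8 * expR 1 ^+ 2 * Num.sqrt alpha) ->
    (1 <= b)%N -> (b %| n)%N ->
    b%:R < n%:R / (c2 * alpha * ln (n%:R / kappa)) ->
    let beta : R := 32 * ln (n%:R / (2 * alpha ^+ 2 * kappa)) in
    let eta : R := b%:R * Num.sqrt alpha * beta / n%:R in
    let tmax := (n %/ b)%N in
    forall (oracle : seq (epoch n b tmax) -> 'cV[R]_d -> 'M[R]_d)
      (x0 : 'cV[R]_d) (s : nat),
    hessian_oracle alpha f oracle ->
    neighborhood f mu L xstar (eps0 * eta) x0 ->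
    1 - 2 * delta <=
      counting_prob R [set w : s.-tuple (epoch n b tmax) |
        f (mb_svrn psi f eta oracle x0 w) - f xstar
          <= (c3 * kappa * alpha ^+ 2 * ln (n%:R / delta) ^+ 2 / n%:R) ^+ s
             * (f x0 - f xstar)]%SET.
Proof.
(* The third constant is the one bounding [24 * theta] in [scalar_params], times the factor 8 by
   which [rho] must exceed [24 * theta]. *)
exists (sample_const R), 1000, (8 * (24 * 5 * 10 ^+ 5 * 96)).
split; first by split; [rewrite exprn_gt0|lra|lra].
have vacuous (t : R) : 1 < t -> 1 - 2 * t <= 0 by lra.
have ln_pos (t : R) : 32 <= 32 * t -> 0 < t by lra.
have const_le : 4 / 125 <= 7 / 8 :> R by lra.
have scale (t a k c u v : R) : t <= a * k * c * u / v ->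
  8 * t <= 8 * a * k * c * u / v by lra.
move=> d n psi f lambda mu L alpha xstar n0 lambda0 mu0 L0 alpha1 f_avg f_C2
  diff_psi convex_psi smooth_psi sc_f lip_f f_min kappa delta eps0 b delta0 hn
  e0 e1 b1 bn hb beta eta tmax oracle x0 s oracleP hx0.
have nR0 : 0 < n%:R :> R by rewrite ltr0n.
have grad0 : grad f xstar = 0.
  exact: (grad_min n0 lambda0 f_avg diff_psi smooth_psi f_min).
have card0 k : (0 < #|{: k.-tuple (epoch n b tmax)}|)%N.
  by rewrite card_tuple expn_gt0 card_epoch_gt0.
have [s0|s0] := posnP s.
  rewrite s0; apply: counting_prob_sure (card0 _) _ (ltW delta0) => w.
  by rewrite tuple0 expr0 mul1r.
have [x0E|x0N] := eqVneq x0 xstar.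
  apply: counting_prob_sure (card0 _) _ (ltW delta0) => w.
  by rewrite x0E /mb_svrn mb_svrn_fixed // !subrr mulr0.
have [delta1|delta1] := leP delta 1; last first.
  apply: (@le_trans _ _ 0); first exact: vacuous.
  by rewrite divr_ge0 ?ler0n.
(* In dimension 0 the start is the minimiser, a case already excluded; in positive dimension
   [kappa >= 1] is available. *)
case: d => [|d] in psi f xstar f_avg f_C2 diff_psi convex_psi smooth_psi sc_f
    lip_f f_min oracle x0 oracleP hx0 grad0 card0 x0N *.
  by move: x0N; rewrite (sub_colmx_dim0 x0 xstar) eqxx.
have smooth_f := smooth_f n0 f_avg diff_psi smooth_psi.
have kappa1 : 1 <= kappa.
  by rewrite ler_pdivlMr // mul1r; exact: strong_convexity_le_smoothness sc_f.
have [q] := scalar_params kappa1 alpha1 delta0 delta1 n0 hn.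
set theta := theta_of n kappa alpha q.+2.
rewrite -/beta => -[[beta32 beta_le /andP[theta0 theta48]] [p_ge exp_le rho_ge]].
have beta0 : 0 < beta by apply: lt_le_trans beta32.
have sa0 := lt_le_trans ltr01 (sqrt_alpha_ge1 alpha1).
have bR0 : 0 < b%:R :> R by rewrite ltr0n.
have lnk0 : 0 < ln (n%:R / kappa).
  exact: (ln_pos _ (le_trans beta32 beta_le)).
have eta_small : eta * Num.sqrt alpha <= 4 / 125.
  exact: (step_size_le alpha1 nR0 bR0 lnk0 hb beta_le).
have eta0 : 0 < eta := divr_gt0 (mulr_gt0 (mulr_gt0 bR0 sa0) beta0) nR0.
have d2_pos : 0 < dist2 f xstar x0.
  have := hess_min_ge xstar L0 f_C2 sc_f lip_f (x0 - xstar).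
  apply: lt_le_trans; rewrite mulr_gt0 // lt_neqAle dotvv_ge0 andbT eq_sym.
  by rewrite dotvv_eq0 subr_eq0.
apply: (svrn_high_prob n0 lambda0 mu0 L0 alpha1 f_avg f_C2 diff_psi convex_psi
  smooth_psi sc_f lip_f f_min b1 bn beta0 theta0 theta48 _ _ exp_le delta0
  delta1 p_ge _ oracleP) => //.
- exact: (le_trans eta_small const_le).
- exact: scale rho_ge.
apply: (neighborhood_dist2_le mu0 L0 alpha1 _ _ _ hx0).
- exact: mulr_ge0 (ltW e0) (ltW eta0).
- exact: (initial_radius_le alpha1 (ltW e0) (ltW e1) (ltW eta0) eta_small).
- exact: ltW.
Qed.
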